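(* Let $r>0$, $1<p<n$, $0<q<p-1$, $0<\alpha<n/p$, and let $\sigma$ be a nonnegative locally finite Borel measure on $\mathbb{R}^n$. Suppose that $\sigma(E)\le C\,\mathrm{cap}_{\alpha,p}(E)$ for all compact $E\subset\mathbb{R}^n$, and $$\int_1^{\infty}\Big(\frac{\sigma(B(0,t))}{t^{n-\alpha p}}\Big)^{\frac1{p-1}}\frac{dt}{t}<\infty.$$ Then there exists a solution $u\in L^q_{\rm loc}(\mathbb{R}^n,d\sigma)$, $u>0$, of $$u=\mathbf{W}_{\alpha,p}(u^q\,d\sigma)+r\quad\text{in }\mathbb{R}^n$$ such that $$c^{-1}\Big(r+\big(\mathbf{W}_{\alpha,p}\sigma\big)^{\frac{p-1}{p-1-q}}\Big)\le u\le c\Big(r+\big(\mathbf{W}_{\alpha,p}\sigma\big)^{\frac{p-1}{p-1-q}}\Big),$$ with $c=c(n,p,q,\alpha,C,r)>0$. Moreover, $u\in L^s_{\rm loc}(\mathbb{R}^n,d\sigma)$ for every $s>0$.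
   Context: $\mathbf{W}_{\alpha,p}\mu(x)=\int_0^\infty\big(\mu(B(x,t))/t^{n-\alpha p}\big)^{\frac1{p-1}}\frac{dt}{t}$ is the Wolff potential; $u^q d\sigma$ is the measure with density $u^q$ w.r.t. $\sigma$. $\mathbf{I}_\alpha f(x)=\int_0^\infty\frac{\int_{B(x,r)}f\,dy}{r^{n-\alpha}}\frac{dr}{r}$ and $\mathrm{cap}_{\alpha,p}(E)=\inf\{\|f\|_{L^p}^p: f\ge0,\ f\in L^p(\mathbb{R}^n),\ \mathbf{I}_\alpha f\ge1\text{ on }E\}$. *)

(* Defs.v *)
From HB Require Import structures.
From mathcomp Require Import all_boot all_order all_algebra.
From mathcomp Require Import all_classical all_reals all_analysis.
From mathcomp Require Import measurable_realfun.
Set Implicit Arguments. Unset Strict Implicit. Unset Printing Implicit Defensive.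
Import Order.TTheory GRing.Theory Num.Theory.
Import numFieldNormedType.Exports.
Local Open Scope classical_set_scope.
Local Open Scope ring_scope.

Definition Rn (R : realType) (n : nat) : Type := 'rV[R]_n.

Section RnMeasurable.
Context (R : realType) (n : nat).
HB.instance Definition _ := Pointed.on (Rn R n).

Definition Rn_borel : set (set (Rn R n)) :=
  <<s [set A : set 'rV[R]_n | open A] >>.

Lemma Rn_borel0 : Rn_borel set0.
Proof. exact: sigma_algebra0. Qed.
Lemma Rn_borelC A : Rn_borel A -> Rn_borel (~` A).
Proof. exact: sigma_algebraC. Qed.
Lemma Rn_borel_bigcup (F : (set (Rn R n))^nat) :
  (forall i, Rn_borel (F i)) -> Rn_borel (\bigcup_i F i).
Proof. exact: sigma_algebra_bigcup. Qed.

HB.instance Definition _ := @isMeasurable.Build default_measure_display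
  (Rn R n) Rn_borel Rn_borel0 Rn_borelC Rn_borel_bigcup.
End RnMeasurable.

Definition edist (R : realType) (n : nat) (x y : Rn R n) : R :=
  Num.sqrt (\sum_(i < n) ((y : 'rV[R]_n) ord0 i - (x : 'rV[R]_n) ord0 i) ^+ 2).

Definition eball (R : realType) (n : nat) (x : Rn R n) (t : R) : set (Rn R n) :=
  [set y | edist x y < t].

Definition origin (R : realType) (n : nat) : Rn R n := (0 : 'rV[R]_n).

(* Lebesgue measure on R^n, built as the iterated product measure
   lambda_{k+1}(A) = \int lambda_k (section of A at x_1) dx_1
   (the same construction as mathcomp's product measure m1 \x m2). *)
Fixpoint lebesgueRn (R : realType) (n : nat) : set (Rn R n) -> \bar R :=
  match n return set (Rn R n) -> \bar R with
  | 0 => fun A => ((\1_A (0 : 'rV[R]_0)) : R)%:E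
  | k.+1 => fun A =>
      (\int[@lebesgue_measure R]_x
         @lebesgueRn R k [set t : Rn R k |
            A (row_mx (\row_(j < 1) x) (t : 'rV[R]_k) : 'rV[R]_(k.+1))])%E
  end.

Definition Ialpha (R : realType) (n : nat) (alpha : R) (f : Rn R n -> R)
    (x : Rn R n) : \bar R :=
  (\int[@lebesgue_measure R]_(r in [set r : R | (0 < r)%R])
     ((\int[@lebesgueRn R n]_(y in eball x r) (f y)%:E) *
      (((powR r (n%:R - alpha))^-1 * r^-1)%R)%:E))%E.

Definition cap_admissible (R : realType) (n : nat) (alpha p : R)
    (E : set (Rn R n)) (f : Rn R n -> R) : Prop :=
  [/\ forall y, 0 <= f y,
      measurable_fun [set: Rn R n] f,
      (\int[@lebesgueRn R n]_y (powR `|f y| p)%:E < +oo)%E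
    & forall x, E x -> (1%:E <= Ialpha alpha f x)%E].

Definition cap (R : realType) (n : nat) (alpha p : R) (E : set (Rn R n)) : \bar R :=
  ereal_inf [set (\int[@lebesgueRn R n]_y (powR `|f y| p)%:E)%E
             | f in cap_admissible alpha p E].

Definition Wolff (R : realType) (n : nat) (alpha p : R)
    (mu : set (Rn R n) -> \bar R) (x : Rn R n) : \bar R :=
  (\int[@lebesgue_measure R]_(t in [set t : R | (0 < t)%R])
     (poweR (mu (eball x t) * ((powR t (n%:R - alpha * p))^-1)%R%:E) (p - 1)^-1%R
      * (t^-1)%R%:E))%E.

Definition density_measure (R : realType) (n : nat)
    (sigma : set (Rn R n) -> \bar R) (u : Rn R n -> \bar R) (q : R)
    : set (Rn R n) -> \bar R :=
  fun A => (\int[sigma]_(y in A) poweR (u y) q)%E.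

Definition locally_finite (R : realType) (n : nat)
    (sigma : set (Rn R n) -> \bar R) : Prop :=
  forall x : Rn R n, exists U : set 'rV[R]_n,
    [/\ open U, U x & (sigma U < +oo)%E].

Definition Lloc (R : realType) (n : nat) (sigma : set (Rn R n) -> \bar R)
    (s : R) (u : Rn R n -> \bar R) : Prop :=
  forall K : set 'rV[R]_n, compact K ->
    (\int[sigma]_(y in (K : set (Rn R n))) poweR `|u y| s < +oo)%E.

(* Main.v *)
Require Import Defs.
From HB Require Import structures.
From mathcomp Require Import all_boot all_order all_algebra.
From mathcomp Require Import all_classical all_reals all_analysis.
From mathcomp Require Import measurable_realfun.
From mathcomp Require Import ring lra.
Import Order.TTheory GRing.Theory Num.Theory.
Import numFieldNormedType.Exports.
Local Open Scope classical_set_scope.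
Local Open Scope ring_scope.

(** Put N = n - alpha p, e = 1/(p-1), W = W_{alpha,p} sigma, gam = (p-1)/(p-1-q), and let
    T_x(a) be the integral defining W(x) restricted to radii > a, so that T_x(0) = W(x).
    Enlarging balls shows T_y(t) <= 4^(N e) T_x(4 t) when |x - y| <= 3 t.

    For a finite measure mu and a level lam, the function
    f(y)^p = int_{lam <~ T_y(t) <~ lam} mu(B(y,2t))^{p'} t^{-(n-alpha)p'} dt/t
    satisfies I_alpha f >~ lam where W mu > 2 lam, whereas Fubini gives
    ||f||_p^p <~ lam mu{W mu >~ lam}, because the T-mass of the radii with T <= M is at most M.
    Testing the capacity with f / lam, the hypothesis sigma <= C cap becomes
    sigma{W mu >= K lam} <~ lam^(1-p) mu{W mu >= lam}. With mu = sigma restricted to a ball B,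
    iteration over lam = K^j lam0 gives int_B (W mu)^s dsigma <~ sigma(B) for every s > 0,
    which controls W((W sigma)^(gam q) dsigma) by W + W^gam and yields the local integrability.

    Hence c1 (r + W^gam) is a supersolution for large c1, max(r, c0 W^gam) is a subsolution for
    small c0, and monotone iteration from the latter gives the solution. *)

Set Implicit Arguments. Unset Strict Implicit. Unset Printing Implicit Defensive.

(** The usual energy bound for f is global, while the weak-type inequality has to keep only the mass
    of a superlevel set. The two-sided cutoff achieves this: its lower level confines z to {W mu >~
    lam}, its upper level caps the T-mass at each z. It is imposed on the tail T rather than on the
    potential because T is comparable at nearby centres, so it can be carried from x to y when
    I_alpha f is bounded below and from y to z in Fubini, each move costing a factor D = 4^(N e).
    Restriction to a ball makes mu finite, and mu <= sigma then yields an estimate with mu on both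
    sides, which can be iterated. The power gam is forced by gam q e + 1 = gam: feeding W^gam into
    the equation returns W^gam. Since q e < 1, a multiple c W^gam comes back with the factor c^(q
    e), which favours small multiples from below and large ones from above; both barrier constants
    are powers x^(1/(1 - q e)). The constant of the theorem may not depend on sigma, so the
    auxiliary constants are chosen before sigma. *)

Local Notation edist := Defs.edist.

(** * Euclidean balls and Borel sets *)

Section euclidean.
Context (R : realType) (n : nat).
Implicit Types (x y z : Rn R n).

Local Notation crd x i := ((x : 'rV[R]_n) ord0 i).

Lemma open_measurable_Rn (A : set 'rV[R]_n) :
  open A -> measurable (A : set (Rn R n)).
Proof. by move=> oA; exact: sub_sigma_algebra. Qed.

Lemma measurable_crd (i : 'I_n) :
  measurable_fun [set: Rn R n] (fun x : Rn R n => crd x i).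
Proof.
apply: (measurability _ (RGenOpens.measurableE R)).
move=> _ [_ [a [b ->]] <-]; rewrite setTI; apply: open_measurable_Rn.
by apply: open_comp => // x _; exact: coord_continuous.
Qed.

(** Lagrange's identity: the defect is half the double sum of the squares (a_i b_j - a_j b_i)^2. *)
Lemma cauchy_schwarz (I : finType) (a b : I -> R) :
  (\sum_i a i * b i) ^+ 2 <= (\sum_i a i ^+ 2) * (\sum_i b i ^+ 2).
Proof.
have : 0 <= \sum_i \sum_j (a i * b j - a j * b i) ^+ 2.
  by apply: sumr_ge0 => i _; apply: sumr_ge0 => j _; exact: sqr_ge0.
have -> : \sum_i \sum_j (a i * b j - a j * b i) ^+ 2 =
   2 * ((\sum_i a i ^+ 2) * (\sum_i b i ^+ 2) - (\sum_i a i * b i) ^+ 2).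
  have -> : \sum_i \sum_j (a i * b j - a j * b i) ^+ 2 =
     \sum_i \sum_j (a i ^+ 2 * b j ^+ 2) + \sum_i \sum_j (b i ^+ 2 * a j ^+ 2)
     - 2 * \sum_i \sum_j ((a i * b i) * (a j * b j)).
    rewrite mulr_sumr -sumrN -!big_split/=; apply: eq_bigr => i _.
    rewrite mulr_sumr -sumrN -!big_split/=; apply: eq_bigr => j _; ring.
  rewrite -!big_distrlr/=; ring.
by rewrite pmulr_rge0// subr_ge0.
Qed.

Lemma minkowski2 (I : finType) (a b : I -> R) :
  Num.sqrt (\sum_i (a i + b i) ^+ 2) <=
  Num.sqrt (\sum_i a i ^+ 2) + Num.sqrt (\sum_i b i ^+ 2).
Proof.
have sq0 (c : I -> R) : 0 <= \sum_i c i ^+ 2 by apply: sumr_ge0 => i _; exact: sqr_ge0.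
rewrite -(@ler_pXn2r _ 2)// ?nnegrE ?addr_ge0 ?sqrtr_ge0//.
rewrite sqr_sqrtr// sqrrD !sqr_sqrtr//.
have -> : \sum_i (a i + b i) ^+ 2 =
   \sum_i a i ^+ 2 + (\sum_i a i * b i) *+ 2 + \sum_i b i ^+ 2.
  by rewrite -sumrMnl -!big_split/=; apply: eq_bigr => i _; rewrite sqrrD.
rewrite lerD2r lerD2l lerMn2r/=.
apply: (le_trans (ler_norm _)); rewrite -sqrtr_sqr -sqrtrM// ler_wsqrtr//.
exact: cauchy_schwarz.
Qed.

Lemma Rn_dist_ge0 x y : 0 <= edist x y.
Proof. exact: sqrtr_ge0. Qed.

Lemma Rn_distC x y : edist x y = edist y x.
Proof. by congr Num.sqrt; apply: eq_bigr => i _; rewrite -sqrrN opprB. Qed.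

Lemma Rn_distxx x : edist x x = 0.
Proof. by rewrite /edist big1 ?sqrtr0// => i _; rewrite subrr expr0n. Qed.

Lemma Rn_dist_triangle y x z : edist x z <= edist x y + edist y z.
Proof.
have := minkowski2 (fun i => crd y i - crd x i) (fun i => crd z i - crd y i).
rewrite (_ : \sum_i _ = \sum_(i < n) (crd z i - crd x i) ^+ 2)//.
by apply: eq_bigr => i _; congr (_ ^+ 2); ring.
Qed.

Lemma coord_le_Rn_dist x y i : `|crd y i - crd x i| <= edist x y.
Proof.
rewrite -sqrtr_sqr ler_wsqrtr// (bigD1 i)//= lerDl.
by apply: sumr_ge0 => j _; exact: sqr_ge0.
Qed.

Lemma Rn_dist_le_coord x y (d : R) : 0 <= d -> (forall i, `|crd y i - crd x i| <= d) ->
  edist x y <= n%:R * d.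
Proof.
move=> d0 h; have nd0 : 0 <= n%:R * d by rewrite mulr_ge0.
rewrite -(ger0_norm nd0) -sqrtr_sqr ler_wsqrtr//.
apply: (@le_trans _ _ (\sum_(i < n) d ^+ 2)).
  by apply: ler_sum => i _; rewrite -[leLHS]real_normK ?num_real// ler_pXn2r ?nnegrE.
rewrite sumr_const card_ord exprMn -[leLHS]mulr_natl; apply: ler_wpM2r; first exact: sqr_ge0.
by rewrite -natrX ler_nat -mulnn; case: n => // m; exact: leq_pmulr.
Qed.

Lemma eball_open x t : open (eball x t : set 'rV[R]_n).
Proof.
rewrite openE => y /=; rewrite /eball/= => xyt.
have d0 : 0 < (t - edist x y) / n.+1%:R by rewrite divr_gt0// subr_gt0.
apply/nbhs_ballP; exists ((t - edist x y) / n.+1%:R) => //= z [_ yz].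
apply: (le_lt_trans (Rn_dist_triangle y _ _)); rewrite -ltrBrDl.
apply: (@le_lt_trans _ _ (n%:R * ((t - edist x y) / n.+1%:R))).
  apply: Rn_dist_le_coord; first exact: ltW.
  by move=> i; rewrite distrC; apply/ltW/yz.
rewrite mulrCA gtr_pMr ?subr_gt0// ltr_pdivrMr// mul1r ltr_nat//.
Qed.

Lemma measurable_eball x t : measurable (eball x t).
Proof. by apply: open_measurable_Rn; exact: eball_open. Qed.

Lemma eball_sub x y s t : edist x y + s <= t -> eball y s `<=` eball x t.
Proof.
move=> h z; rewrite /eball/= => yz.
by rewrite (le_lt_trans (Rn_dist_triangle y _ _))// (lt_le_trans _ h)// ltrD2l.
Qed.

Lemma eballS x s t : s <= t -> eball x s `<=` eball x t.
Proof. by move=> st; apply: eball_sub; rewrite Rn_distxx add0r. Qed.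

End euclidean.

Section measurable_into_Rn.
Context (R : realType) (n : nat).

(** An open set is the countable union of the boxes with rational centre and side 1/(k+1) scale that
    it contains, and the preimage of a box is a finite intersection of coordinate preimages. *)
Lemma measurable_fun_coordP d (T : measurableType d) (f : T -> Rn R n) :
  (forall i, measurable_fun setT (fun t => (f t : 'rV[R]_n) ord0 i)) ->
  measurable_fun setT f.
Proof.
move=> mf; pose G := [set A : set 'rV[R]_n | open A].
apply: (measurability (G : set (set (Rn R n)))) => //.
move=> _ [A oA <-]; rewrite setTI.
pose bx (k : 'rV[rat]_n * nat) : set 'rV[R]_n :=
  [set y | forall i, ball (ratr (k.1 ord0 i) : R) (k.2.+1%:R^-1) (y ord0 i)].
have -> : f @^-1` A = \bigcup_(k in [set k | bx k `<=` A]) f @^-1` (bx k).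
  rewrite -preimage_bigcup; congr (_ @^-1` _); apply/seteqP; split; last first.
    by move=> y [k /= kA]; exact: kA.
  move=> y Ay; have : open (A : set (topology_structure.Topological.sort _)) := oA; rewrite openE => /(_ _ Ay) /nbhs_ballP[e/= e0 yeA].
  have [k ke] : exists k : nat, k.+1%:R^-1 < e / 2.
    exists (Num.trunc (e / 2)^-1); rewrite invf_plt ?posrE ?divr_gt0//.
    exact: truncnS_gt.
  have hq i : exists q : rat, ball (ratr q : R) (k.+1%:R^-1) (y ord0 i).
    have [|q qi] := @rat_in_itvoo R (y ord0 i) (y ord0 i + k.+1%:R^-1).
      by rewrite ltrDl invr_gt0.
    exists q; rewrite /ball/=; move: qi; rewrite in_itv/= => /andP[q1 q2].
    by rewrite ger0_norm ?subr_ge0 ?(ltW q1)// ltrBlDl.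
  have [q qP] := choice hq.
  exists (\row_i q i, k) => /=; last by move=> i; rewrite /= mxE.
  move=> z /= yz; apply: yeA; split => // i j; rewrite (ord1 i).
  have := yz j; have := qP j; rewrite /ball/= mxE.
  move=> h1 h2; rewrite -(subrK (ratr (q j)) (y ord0 j)) -addrA.
  rewrite (le_lt_trans (ler_normD _ _))// (splitr e) ltrD//.
    by rewrite distrC (lt_trans h1).
  by rewrite (lt_trans h2).
rewrite bigcup_mkcond; apply: countable_bigcupT_measurable => // k.
case: ifP => // _.
have -> : f @^-1` bx k = \bigcap_(i in [set: 'I_n])
   [set t | ball (ratr (k.1 ord0 i) : R) (k.2.+1%:R^-1) ((f t : 'rV[R]_n) ord0 i)].
  by apply/seteqP; split => [t /= h i _|t h i]; exact: h.
apply: fin_bigcap_measurable => // i _.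
rewrite -[X in measurable X]setTI; apply: (mf i) => //.
by apply: open_measurable; exact: ball_open.
Qed.
End measurable_into_Rn.

(** * Lebesgue measure of balls *)

Section with_sigma_finite.
Context d (T : measurableType d) (R : realType) (mu : {measure set T -> \bar R}).
Hypothesis sf : sigma_finite [set: T] mu.

(** An alias indexed by the proof of sigma-finiteness, on which the bundled structure can be
    declared without changing the underlying function. *)
Definition with_sigma_finite of sigma_finite [set: T] mu : set T -> \bar R := mu.
Let mu' := with_sigma_finite sf.
HB.instance Definition _ := Measure.on mu'.
HB.instance Definition _ := Measure_isSigmaFinite.Build _ _ _ mu' sf.

Lemma sigma_finite_measureP : exists nu : {sigma_finite_measure set T -> \bar R},
  nu = mu :> (set T -> \bar R).
Proof. by exists mu'. Qed.
End with_sigma_finite.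

Section lebesgueRn.
Context (R : realType).

Lemma measurable_Rn_dist n : measurable_fun [set: Rn R n * Rn R n]
  (fun z => edist z.1 z.2).
Proof.
apply: (@measurableT_comp _ _ _ _ _ _ (@Num.sqrt R) _
  (fun z : Rn R n * Rn R n => \sum_(i < n) ((z.2 : 'rV[R]_n) ord0 i - (z.1 : 'rV[R]_n) ord0 i) ^+ 2)).
  by apply: continuous_measurable_fun; exact: sqrt_continuous.
apply: measurable_sum => i; apply: measurable_funX; apply: measurable_funB.
  by apply: (measurableT_comp (@measurable_crd R n i)).
by apply: (measurableT_comp (@measurable_crd R n i)).
Qed.

Lemma sigma_finite_balls n (mu : {measure set (Rn R n) -> \bar R}) :
  (forall t, (mu (eball (origin R n) t) < +oo)%E) ->
  exists mu' : {sigma_finite_measure set (Rn R n) -> \bar R},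
    mu' = mu :> (set (Rn R n) -> \bar R).
Proof.
move=> fin.
have sf : sigma_finite [set: Rn R n] mu.
  exists (fun i => eball (origin R n) i%:R); last first.
    by move=> i; split; [exact: measurable_eball|exact: fin].
  apply/seteqP; split => // x _; exists (Num.trunc (edist (origin R n) x)).+1 => //.
  exact: truncnS_gt.
exact: sigma_finite_measureP sf.
Qed.

Definition ebox n (x : Rn R n) (s : R) : set (Rn R n) :=
  [set y | forall i, `|(y : 'rV[R]_n) ord0 i - (x : 'rV[R]_n) ord0 i| < s].

Lemma measurable_ebox n (x : Rn R n) s : measurable (ebox x s).
Proof.
have -> : ebox x s = \bigcap_(i in [set: 'I_n])
   [set y : Rn R n | ball ((x : 'rV[R]_n) ord0 i) s ((y : 'rV[R]_n) ord0 i)].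
  apply/seteqP; split => [y /= h i _|y h i].
    by rewrite /ball/= distrC.
  by have := h i Logic.I; rewrite /ball/= distrC.
apply: fin_bigcap_measurable => // i _.
rewrite -[X in measurable X]setTI; apply: measurable_crd => //.
by apply: open_measurable; exact: ball_open.
Qed.

Lemma ball_sub_ebox n (x : Rn R n) t : eball x t `<=` ebox x t.
Proof. by move=> y xy i; apply: le_lt_trans xy; exact: coord_le_Rn_dist. Qed.

Lemma ebox_sub_ball n (x : Rn R n) t : 0 < t -> ebox x (t / n.+1%:R) `<=` eball x t.
Proof.
move=> t0 y xy; apply: (@le_lt_trans _ _ (n%:R * (t / n.+1%:R))).
  by apply: Rn_dist_le_coord; [rewrite divr_ge0// ltW|move=> i; exact/ltW/xy].
by rewrite mulrCA gtr_pMr// ltr_pdivrMr// mul1r ltr_nat.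
Qed.

(** In spite of the name, [z.1] becomes the first coordinate, as in the recursion of
    [lebesgueRn]. *)
Definition rcons_coord k (z : R * Rn R k) : Rn R k.+1 :=
  (row_mx (\row_(j < 1) z.1) (z.2 : 'rV[R]_k) : 'rV[R]_(1 + k)).

Lemma rcons_coord0 k (z : R * Rn R k) : (rcons_coord z : 'rV[R]_k.+1) ord0 ord0 = z.1.
Proof.
rewrite /rcons_coord; have -> : ord0 = lshift k (ord0 : 'I_1) by exact: val_inj.
by rewrite (@row_mxEl _ 1 1 k) mxE.
Qed.

Lemma rcons_coordS k (z : R * Rn R k) i :
  (rcons_coord z : 'rV[R]_k.+1) ord0 (lift ord0 i) = (z.2 : 'rV[R]_k) ord0 i.
Proof.
rewrite /rcons_coord; have -> : lift ord0 i = rshift 1 i by exact: val_inj.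
by rewrite (@row_mxEr _ 1 1 k).
Qed.

Lemma measurable_rcons_coord k :
  measurable_fun [set: measurableTypeR R * Rn R k] (@rcons_coord k).
Proof.
apply: measurable_fun_coordP => i; case: (unliftP ord0 i) => [j|] ->.
  under eq_fun do rewrite rcons_coordS.
  by apply: (measurableT_comp (@measurable_crd R k j)).
under eq_fun do rewrite rcons_coord0.
exact: measurable_fst.
Qed.

Lemma ball_setE (x s : R) : 0 < s ->
  [set y : R | `|y - x| < s] = `]x - s, x + s[%classic.
Proof.
move=> s0; apply/seteqP; split => y /=; rewrite in_itv/= ltr_norml => /andP[? ?];
  by apply/andP; split; lra.
Qed.

(** [lebesgueRn] is given as a bare set function. By induction it is the pushforward of a product
    measure under [rcons_coord], hence a measure; the box volumes come along and give the
    sigma-finiteness that Tonelli's theorem asks for. *)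
Lemma lebesgueRnP k : exists mu : {sigma_finite_measure set (Rn R k) -> \bar R},
  mu = @lebesgueRn R k :> (set (Rn R k) -> \bar R) /\
  forall x s, 0 < s -> mu (ebox x s) = ((2 * s) ^+ k)%:E.
Proof.
elim: k => [|k [mu [muE mubox]]].
  have [mu' mu'E] := @sigma_finite_balls 0 (\d_ (0 : Rn R 0))
    (fun t => le_lt_trans (probability_le1 _ (measurable_eball _ _)) (ltry _)).
  exists mu'; split; first by rewrite mu'E; exact/funext.
  move=> x s s0; rewrite mu'E expr0 -[LHS]/((\1_(ebox x s) (0 : Rn R 0))%:E) indicE mem_set//.
  by case.
have E : (pushforward (@lebesgue_measure R \x mu)%E (@rcons_coord k)) = @lebesgueRn R k.+1.
  by rewrite /= -muE; apply/funext => A; rewrite /pushforward/product_measure1/=;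
   apply: eq_integral => x _; congr (mu _); apply/seteqP; split => y/=; rewrite /xsection/= inE.
pose phi := @rcons_coord k : measurableTypeR R * Rn R k -> Rn R k.+1.
have mphi : measurable_fun setT phi by exact: measurable_rcons_coord.
pose nu : {measure set (Rn R k.+1) -> \bar R} :=
  measure_function_pushforward__canonical__measure_function_Measure (@lebesgue_measure R \x mu)%E mphi.
have nubox x s : 0 < s -> nu (ebox x s) = ((2 * s) ^+ k.+1)%:E.
  move=> s0; pose x0 := (x : 'rV[R]_k.+1) ord0 ord0.
  pose x1 : Rn R k := (\row_i (x : 'rV[R]_k.+1) ord0 (lift ord0 i) : 'rV[R]_k).
  have hs : phi @^-1` ebox x s = [set y : R | `|y - x0| < s] `*` ebox x1 s.
    apply/seteqP; split => [[a b] /= h|[a b] /= [h0 h1] i].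
      split; first by have := h ord0; rewrite rcons_coord0.
      by move=> i; have := h (lift ord0 i); rewrite rcons_coordS mxE.
    case: (unliftP ord0 i) => [j|] ->.
      by rewrite rcons_coordS; have := h1 j; rewrite mxE.
    by rewrite rcons_coord0.
  rewrite -[LHS]/((@lebesgue_measure R \x mu)%E (phi @^-1` ebox x s)) hs.
  rewrite ball_setE// product_measure1E//; last exact: measurable_ebox.
  have hl : lebesgue_measure (`]x0 - s, x0 + s[%classic : set R) = (2 * s)%:E.
    rewrite lebesgue_measure_itv/= lte_fin ltrD2l gtrN// EFinN -EFinB.
    by congr (_%:E); ring.
  by rewrite mubox// exprS EFinM -hl.
have fin t : (nu (eball (origin R k.+1) t) < +oo)%E.
  apply: (@le_lt_trans _ _ (nu (ebox (origin R k.+1) (`|t| + 1)))); last first.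
    by rewrite nubox ?ltry// ltr_wpDl.
  apply: le_measure; rewrite ?inE; [exact: measurable_eball|exact: measurable_ebox|].
  apply: subset_trans (@ball_sub_ebox _ _ _); apply: eballS.
  by rewrite (le_trans (ler_norm t))// lerDl.
have [nu' nu'E] := sigma_finite_balls fin.
by exists nu'; rewrite nu'E; split => //; rewrite -E.
Qed.

(** The ball is squeezed between cubes of half-side t/(n+1) and t. The constant v enters the lower
    bound of I_alpha f, and V the Fubini estimate. *)
Lemma lebesgueRn_ballP n : exists mu : {sigma_finite_measure set (Rn R n) -> \bar R},
  mu = @lebesgueRn R n :> (set (Rn R n) -> \bar R) /\
  exists v V : R, [/\ 0 < v, 0 < V & forall x t, 0 < t ->
    ((v * t ^+ n)%:E <= mu (eball x t) <= (V * t ^+ n)%:E)%E].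
Proof.
have [mu [muE mub]] := lebesgueRnP n; exists mu; split => //.
exists ((2 / n.+1%:R) ^+ n), (2 ^+ n).
split; [by rewrite exprn_gt0// divr_gt0|by rewrite exprn_gt0|move=> x t t0].
apply/andP; split.
  apply: (@le_trans _ _ (mu (ebox x (t / n.+1%:R)))).
    by rewrite mub ?divr_gt0// -exprMn lee_fin mulrCA mulrC mulrA.
  by apply: le_measure; rewrite ?inE;
    [exact: measurable_ebox|exact: measurable_eball|exact: ebox_sub_ball].
rewrite -exprMn -(mub x)//; apply: le_measure; rewrite ?inE;
  [exact: measurable_eball|exact: measurable_ebox|exact: ball_sub_ebox].
Qed.
End lebesgueRn.

(** * Integrals over half-lines *)

(** A set-builder rather than an interval, so that [ray 0] is convertible with the integration
    domains of [Wolff] and [Ialpha]. *)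
Definition ray (R : realType) (a : R) : set R := [set t | a < t].
Arguments ray : simpl never.

Section ray.
Context {R : realType}.
Implicit Types (a t : R) (h : R -> \bar R).
Local Open Scope ereal_scope.
Local Notation leb := (@lebesgue_measure R).

Lemma rayE a : ray a = `]a, +oo[%classic.
Proof. by apply/seteqP; split => t; rewrite /ray/= in_itv/= andbT. Qed.

Lemma measurable_ray a : measurable (ray a).
Proof. by rewrite rayE; exact: measurable_itv. Qed.

Lemma subset_ray a b : (a <= b)%R -> ray b `<=` ray a.
Proof. by move=> ab t; exact: le_lt_trans. Qed.

(** The rescaled pushforward agrees with Lebesgue measure on half-open intervals, and uniqueness of
    Lebesgue measure does the rest. *)
Lemma lebesgue_dilation (c : R) (c0 : (0 < c)%R) (A : set R) : measurable A ->
  leb A = c%:E * leb [set t | A (c * t)%R].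
Proof.
move=> mA; pose phi := ( *%R c : measurableTypeR R -> measurableTypeR R).
have mphi : measurable_fun setT phi by exact: mulrl_measurable.
pose nu : {measure set (measurableTypeR R) -> \bar R} :=
  mscale (NngNum (ltW c0)) (measure_function_pushforward__canonical__measure_function_Measure leb mphi).
rewrite (@lebesgue_measure_unique R nu)//= => _ [[a b] _ <-].
rewrite /nu /mscale/= /pushforward/=.
have -> : phi @^-1` `]a, b] = (`](a / c)%R, (b / c)%R]%classic : set R).
  by apply/seteqP; split => t; rewrite /phi/= !in_itv/= ltr_pdivrMr// ler_pdivlMr// ![(t * _)%R]mulrC.
rewrite !lebesgue_measure_itv/= !lte_fin ltr_pM2r ?invr_gt0//.
case: ifPn => ab; last by rewrite mule0.
by rewrite -!EFinD -EFinM -mulrBl mulrCA mulfV ?mulr1// gt_eqF.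
Qed.

Lemma ge0_integral_dilation (c : R) a h : (0 < c)%R ->
  measurable_fun setT h -> (forall t, 0 <= h t) ->
  \int[leb]_(t in ray (c * a)%R) h t = c%:E * \int[leb]_(t in ray a) h (c * t)%R.
Proof.
move=> c0 mh h0; pose phi := ( *%R c : measurableTypeR R -> measurableTypeR R).
have mphi : measurable_fun setT phi by exact: mulrl_measurable.
pose nu : {measure set (measurableTypeR R) -> \bar R} :=
   (measure_function_pushforward__canonical__measure_function_Measure leb mphi).
rewrite (eq_measure_integral (mscale (NngNum (ltW c0)) nu)); last first.
  by move=> A mA _; exact: (lebesgue_dilation c0 mA).
rewrite ge0_integral_mscale//; [|exact: measurable_ray|exact: measurable_funTS].
congr (_ * _); rewrite (ge0_integral_pushforward mphi)//; last 2 first.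
- exact: measurable_ray.
- exact: measurable_funTS.
by congr (integral _ _ _); apply/seteqP; split => t; rewrite /ray/phi/= ltr_pM2l.
Qed.

Lemma ge0_integral_bigcup_le (d : measure_display) (T : measurableType d)
    (mu : {measure set T -> \bar R}) (F : (set T)^nat) (f : T -> \bar R) (M : \bar R) :
  nondecreasing_seq F -> (forall i, measurable (F i)) ->
  measurable_fun setT f -> (forall x, 0 <= f x) ->
  (forall i, \int[mu]_(x in F i) f x <= M) -> \int[mu]_(x in \bigcup_i F i) f x <= M.
Proof.
move=> ndF mF mf f0 FM.
have := @ge0_nondecreasing_set_cvg_integral _ _ _ F f mu ndF mF
  (fun i => measurable_funTS mf) (fun i x _ => f0 x).
move=> /cvg_lim <- //; apply: lime_le; last exact: nearW.
apply: ereal_nondecreasing_is_cvgn; apply: ge0_nondecreasing_set_nondecreasing_integral => //.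
by move=> i; exact: measurable_funTS.
Qed.

Lemma ray_bigcup a : ray a = \bigcup_k ray (a + k.+1%:R^-1)%R.
Proof.
apply/seteqP; split => [t at_|t [k _]]; last first.
  by apply: subset_ray; rewrite lerDl.
exists (Num.trunc (t - a)^-1) => //; rewrite /ray/= -ltrBrDl.
by rewrite invf_plt ?posrE ?subr_gt0//; exact: truncnS_gt.
Qed.

Lemma nondecreasing_rays a : nondecreasing_seq (fun k : nat => ray (a + k.+1%:R^-1)%R).
Proof.
move=> k m km; rewrite subsetEset; apply: subset_ray.
by rewrite lerD2l lef_pV2 ?posrE// ler_nat.
Qed.

(** Monotone convergence along the rays starting at a + 1/(k+1). *)
Lemma integral_ray_gt h a (M : \bar R) : measurable_fun setT h -> (forall t, 0 <= h t) ->
  M < \int[leb]_(t in ray a) h t -> exists2 b, (a < b)%R & M < \int[leb]_(t in ray b) h t.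
Proof.
move=> mh h0 hM; apply: contrapT => /forall2NP nex.
suff : \int[leb]_(t in ray a) h t <= M by rewrite leNgt hM.
rewrite ray_bigcup; apply: ge0_integral_bigcup_le => //.
- exact: nondecreasing_rays.
- by move=> i; exact: measurable_ray.
move=> i; rewrite leNgt; apply/negP => bad.
by have [|/(_ bad)] := nex (a + i.+1%:R^-1)%R; rewrite ?ltrDl//.
Qed.

Lemma is_interval_upclosed (S : set R) :
  (forall s t, S s -> (s <= t)%R -> S t) -> is_interval S.
Proof. by move=> up x y Sx Sy z /andP[xz zy]; exact: up xz. Qed.

Section tail_levels.
Variable h : R -> \bar R.
Hypothesis mh : measurable_fun setT h.
Hypothesis h0 : forall t, 0 <= h t.
Let T a := \int[leb]_(t in ray a) h t.

Lemma tail_nonincreasing a b : (a <= b)%R -> T b <= T a.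
Proof.
move=> ab; apply: ge0_subset_integral => //; [exact: measurable_ray|exact: measurable_ray| |].
- exact: measurable_funTS.
- exact: subset_ray.
Qed.

Definition low_tail a M := [set t | (a < t)%R /\ T t <= M].

Lemma low_tail_up a M s t : low_tail a M s -> (s <= t)%R -> low_tail a M t.
Proof.
move=> [as_ sM] st; split; first exact: lt_le_trans st.
exact: le_trans (tail_nonincreasing st) sM.
Qed.

Lemma measurable_low_tail a M : measurable (low_tail a M).
Proof.
apply: is_interval_measurable; apply: is_interval_upclosed => s t; exact: low_tail_up.
Qed.

(** The set is a half-line from its infimum. If it contains the infimum, the tail bound there
    applies, since a point is negligible; otherwise it is exhausted by the rays from inf + 1/(k+1),
    each of tail at most M. *)
Lemma integral_low_tail_le a M : 0 <= M -> \int[leb]_(t in low_tail a M) h t <= M.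
Proof.
move=> M0; set S := low_tail a M.
have [S0|/set0P Sn0] := eqVneq S set0; first by rewrite S0 integral_set0.
have hlb : has_inf S by split => //; exists a => t [/ltW].
have [Si|Si] := pselect (S (inf S)).
  apply: (@le_trans _ _ (T (inf S))); last by case: Si.
  have -> : T (inf S) = \int[leb]_(t in `[inf S, +oo[) h t.
    by rewrite /T rayE integral_itv_obnd_cbnd//; exact: measurable_funTS.
  apply: ge0_subset_integral => //; [exact: measurable_low_tail|exact: measurable_funTS|].
  by move=> t St/=; rewrite in_itv/= andbT; by apply: ge_inf => //; case: hlb.
have infS t : S t -> (inf S < t)%R.
  move=> St; rewrite lt_neqAle ge_inf// ?andbT; last by case: hlb.
  by apply/eqP => E; apply: Si; rewrite E.
have Sk (k : nat) : S (inf S + k.+1%:R^-1)%R.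
  have k0 : (0 < (k.+1%:R^-1 : R))%R by rewrite invr_gt0.
  have [s Ss /ltW ?] := inf_adherent k0 hlb; exact: low_tail_up Ss _.
have -> : S = ray (inf S).
  apply/seteqP; split => [t /infS //|t]; rewrite ray_bigcup => -[k _ /ltW].
  exact: low_tail_up (Sk k).
rewrite ray_bigcup; apply: ge0_integral_bigcup_le => //.
- exact: nondecreasing_rays.
- by move=> i; exact: measurable_ray.
by move=> i; have [] := Sk i.
Qed.

(** The complement G of the low tail is an initial interval. For t in G the mass of (a, t] is T a -
    T t, hence at most T a - M, and such intervals exhaust G. With the upper bound above, the levels
    between lam and 2 lam carry mass at least lam. *)
Lemma integral_low_tail_ge a (M : R) : T a < +oo -> (0 <= M)%R -> M%:E < T a ->
  M%:E <= \int[leb]_(t in low_tail a M%:E) h t.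
Proof.
move=> Tfin M0 MT; set S := low_tail a M%:E.
have mS : measurable S by exact: measurable_low_tail.
pose G := ray a `\` S.
have mG : measurable G by apply: measurableD => //; exact: measurable_ray.
have TE : T a = \int[leb]_(t in G) h t + \int[leb]_(t in S) h t.
  have -> : T a = \int[leb]_(t in G `|` S) h t.
    by rewrite /T /G setUC setDUK// => t [].
  rewrite ge0_integral_setU//; first exact: measurable_funTS.
  by rewrite disj_set2E setDKI.
have T0 t : 0 <= T t by exact: integral_ge0.
have Tafin : T a \is a fin_num by rewrite ge0_fin_numE.
suff GM : \int[leb]_(t in G) h t <= T a - M%:E.
  move: GM TE Tafin; have : 0 <= \int[leb]_(t in S) h t by exact: integral_ge0.
  have : 0 <= \int[leb]_(t in G) h t by exact: integral_ge0.
  move: (T a) (\int[leb]_(t in G) h t) (\int[leb]_(t in S) h t).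
  move=> [x| |] [y| |] [z| |]//; rewrite ?leey//= -?EFinN -?EFinD !lee_fin.
  by move=> _ _ h1 [h2] _; lra.
have seg t : G t -> \int[leb]_(s in `]a, t]) h s <= T a - M%:E.
  move=> [at_ /not_andP[//|/negP]]; rewrite -ltNge => Mt.
  have E : T a = \int[leb]_(s in `]a, t]) h s + T t.
    rewrite -ge0_integral_setU//; [|exact: measurable_ray|exact: measurable_funTS|].
      rewrite /T !rayE; congr (integral _ _ _).
      by rewrite -itv_bndbnd_setU// bnd_simp ltW.
    rewrite disj_set2E; apply/eqP/seteqP; split => // s [].
    by rewrite /ray/= in_itv/= => /andP[_ st] /(le_lt_trans st); rewrite ltxx.
  have Tt : T t \is a fin_num.
    by rewrite ge0_fin_numE//; apply: le_lt_trans Tfin; apply: tail_nonincreasing; exact: ltW.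
  rewrite -[leLHS](addeK _ Tt) -E leeB//; exact: ltW.
have sub0 : 0 <= T a - M%:E by rewrite sube_ge0 ?fin_numE ?orbT// ltW.
have Gdown s t : G t -> (a < s)%R -> (s <= t)%R -> G s.
  by move=> [at_ nSt] as_ st; split => // Ss; apply: nSt; exact: low_tail_up st.
have [G0|/set0P Gn0] := eqVneq G set0; first by rewrite G0 integral_set0.
(* G may be unbounded, contain its supremum, or miss it; each case supplies its own sequence u. An
   index with u_k <= a gives an empty interval and is harmless. *)
have cover (u : nat -> R) : nondecreasing_seq u -> (forall k, G (u k) \/ (u k <= a)%R) ->
    G `<=` \bigcup_k `]a, u k]%classic -> \int[leb]_(t in G) h t <= T a - M%:E.
  move=> ndu Gu GU; apply: (@le_trans _ _ (\int[leb]_(t in \bigcup_k `]a, u k]%classic) h t)).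
    apply: ge0_subset_integral => //; last exact: measurable_funTS.
    exact: bigcup_measurable.
  apply: ge0_integral_bigcup_le => //.
    move=> k m km; rewrite subsetEset => t/=; rewrite !in_itv/= => /andP[-> tk]/=.
    by rewrite (le_trans tk)// ndu.
  move=> k; have [/seg //|ua] := Gu k.
  by rewrite set_itv_ge ?integral_set0// bnd_simp -leNgt.
have [ubG|nubG] := pselect (has_ubound G); last first.
  apply: (cover (fun k => k%:R)).
  - by move=> k m km; rewrite ler_nat.
  - move=> k; have [ka|ak] := leP k%:R%R a; [by right|left].
    apply: contrapT => nGk; apply: nubG; exists k%:R%R => t Gt.
    rewrite leNgt; apply/negP => kt; apply: nGk; exact: Gdown Gt ak (ltW kt).
  - move=> t [at_ _]; exists (Num.trunc t).+1 => //=; rewrite in_itv/= at_/=.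
    exact/ltW/truncnS_gt.
have supG : has_sup G by [].
have [Gs|nGs] := pselect (G (sup G)).
  apply: (cover (fun=> sup G)) => //; first by move=> _; left.
  move=> t Gt; exists 0%N => //=; rewrite in_itv/= ub_le_sup// andbT.
  by case: Gt.
apply: (cover (fun k => sup G - k.+1%:R^-1)%R).
- by move=> k m km; rewrite lerD2l lerN2 lef_pV2 ?posrE// ler_nat.
- move=> k; have [ka|ak] := leP (sup G - k.+1%:R^-1)%R a; [by right|left].
  have k0 : (0 < (k.+1%:R^-1 : R))%R by rewrite invr_gt0.
  by have [s Gs /ltW ?] := sup_adherent k0 supG; exact: Gdown Gs ak _.
- move=> t Gt; have tG : (t < sup G)%R.
    rewrite lt_neqAle ub_le_sup// andbT; apply/eqP => E; apply: nGs; by rewrite -E.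
  have : ray t (sup G) by [].
  rewrite ray_bigcup => -[k _]; rewrite /ray/= => tk; exists k => //=.
  by rewrite in_itv/=; case: Gt => -> _ /=; rewrite lerBrDr ltW.
Qed.
End tail_levels.
End ray.

(** * Truncated Wolff potentials *)

Section poweR_facts.
Context {R : realType}.
Local Open Scope ereal_scope.

Lemma le_poweR (e : R) (x y : \bar R) : (0 <= e)%R -> 0 <= x -> x <= y ->
  poweR x e <= poweR y e.
Proof.
move=> e0 x0 xy; apply: gt0_ler_poweR => //; rewrite in_itv/= ?x0 ?leey//.
by rewrite (le_trans x0 xy).
Qed.

Lemma poweRZl (c e : R) (x : \bar R) : (0 <= c)%R -> 0 <= x ->
  poweR (c%:E * x) e = (c `^ e)%:E * poweR x e.
Proof. by move=> c0 x0; rewrite poweRM ?lee_fin// poweR_EFin. Qed.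
End poweR_facts.

(** The properties of a set function that the Wolff potential sees. One theory thus covers sigma,
    its restrictions to balls, and [density_measure], which is defined as a bare set function. Joint
    measurability in centre and radius is for Tonelli's theorem. *)
Record ball_function (R : realType) (n : nat) (m : set (Rn R n) -> \bar R) : Prop := {
  bf0 : m set0 = 0%E ;
  bf_ge0 : forall x t, (0 <= m (eball x t))%E ;
  bf_le : forall x y s t, eball x s `<=` eball y t -> (m (eball x s) <= m (eball y t))%E ;
  bf_meas : measurable_fun setT (fun z : Rn R n * R => m (eball z.1 z.2)) }.

Section ball_functions.
Context (R : realType) (n : nat).
Local Open Scope ereal_scope.

Lemma eball0 (x : Rn R n) t : (t <= 0)%R -> eball x t = set0.
Proof.
move=> t0; apply/seteqP; split => // y; rewrite /eball/= => /lt_le_trans -/(_ _ t0).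
by rewrite ltNge Rn_dist_ge0.
Qed.

Lemma measurable_ball_graph : measurable
  [set w : (Rn R n * R) * Rn R n | eball w.1.1 w.1.2 w.2].
Proof.
have m1 : measurable_fun setT (fun w : (Rn R n * R) * Rn R n => edist w.1.1 w.2).
  apply: (@measurableT_comp _ _ _ _ _ _ (fun z : Rn R n * Rn R n => edist z.1 z.2) _
    (fun w : (Rn R n * R) * Rn R n => (w.1.1, w.2))); first exact: measurable_Rn_dist.
  apply: measurable_fun_pair; last exact: measurable_snd.
  by apply: measurableT_comp; [exact: measurable_fst|exact: measurable_fst].
have m2 : measurable_fun setT (fun w : (Rn R n * R) * Rn R n => w.1.2).
  by apply: measurableT_comp; [exact: measurable_snd|exact: measurable_fst].
have := measurable_fun_ltr m1 m2.
by move=> /(_ measurableT [set true]); rewrite setTI; apply.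
Qed.

Variable mu : {sigma_finite_measure set (Rn R n) -> \bar R}.

(** Joint measurability is Tonelli's theorem for g times the indicator of the set in
    [measurable_ball_graph]. *)
Lemma ball_function_density (g : Rn R n -> \bar R) :
  measurable_fun setT g -> (forall y, 0 <= g y) ->
  ball_function (fun A => \int[mu]_(y in A) g y).
Proof.
move=> mg g0; split.
- by rewrite integral_set0.
- by move=> x t; exact: integral_ge0.
- move=> x y s t st; apply: ge0_subset_integral => //; [exact: measurable_eball|
    exact: measurable_eball|exact: measurable_funTS].
pose f (w : (Rn R n * R) * Rn R n) :=
  g w.2 * (\1_[set w : (Rn R n * R) * Rn R n | eball w.1.1 w.1.2 w.2] w)%:E.
have mf : measurable_fun setT f.
  apply: emeasurable_funM; first by apply: measurableT_comp => //; exact: measurable_snd.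
  apply/measurable_EFinP; apply: measurable_indic; exact: measurable_ball_graph.
have f0 w : 0 <= f w by rewrite mule_ge0.
have := @measurable_fun_fubini_tonelli_F _ _ _ _ _ mu f mf f0.
congr (measurable_fun _ _); apply/funext => -[x t]; rewrite /fubini_F /=.
rewrite [RHS]integral_mkcond; apply: eq_integral => y _.
rewrite /f/= indicE /patch/=; case: ifPn => yb.
  by rewrite mem_set ?mule1//; rewrite inE in yb.
by rewrite memNset ?mule0//; move=> h; move/negP: yb; apply; rewrite inE.
Qed.

Lemma ball_function_measure : ball_function mu.
Proof.
have := @ball_function_density (cst 1) (measurable_cst _) (fun=> lee01).
move=> [h1 h2 h3 h4]; split.
- exact: measure0.
- by move=> x t; exact: measure_ge0.
- by move=> x y s t st; apply: le_measure => //; rewrite inE; exact: measurable_eball.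
- move: h4; congr (measurable_fun _ _); apply/funext => z.
  by rewrite integral_cst ?mul1e//; exact: measurable_eball.
Qed.
End ball_functions.

Definition wolff_den (R : realType) (n : nat) (N e : R) (m : set (Rn R n) -> \bar R)
    (x : Rn R n) (t : R) : \bar R :=
  (poweR (m (eball x t) * ((powR t N)^-1)%R%:E) e * (t^-1)%R%:E)%E.

(** At a = 0 and the right N, e this is convertible with [Wolff]. *)
Definition wolff_tail (R : realType) (n : nat) (N e : R) (m : set (Rn R n) -> \bar R)
    (x : Rn R n) (a : R) : \bar R :=
  (\int[@lebesgue_measure R]_(t in ray a) wolff_den N e m x t)%E.

Section wolff_tail.
Context (R : realType) (n : nat) (N e : R).
Hypotheses (N0 : 0 < N) (e0 : 0 < e).
Variable m : set (Rn R n) -> \bar R.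
Hypothesis bm : ball_function m.
Local Open Scope ereal_scope.
Local Notation h := (wolff_den N e m).
Local Notation T := (wolff_tail N e m).
Local Notation leb := (@lebesgue_measure R).

(** Negative powers in place of inverses make measurability on the whole line immediate; at t <= 0
    the ball is empty and both sides vanish. *)
Lemma wolff_den_powR x t : h x t =
  poweR (m (eball x t) * (powR t (- N))%:E) e * (powR t (-1))%:E.
Proof.
have [t0|t0] := leP t 0%R.
  by rewrite /wolff_den eball0// bf0// !mul0e poweR0r ?mul0e// gt_eqF.
by rewrite /wolff_den powRN powR_inv1// ltW.
Qed.

Lemma wolff_den_ge0 x t : 0 <= h x t.
Proof. by rewrite wolff_den_powR mule_ge0 ?poweR_ge0// lee_fin powR_ge0. Qed.

Lemma measurable_wolff_den : measurable_fun setT (fun z : Rn R n * R => h z.1 z.2).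
Proof.
under eq_fun do rewrite wolff_den_powR.
have mp (c : R) : measurable_fun setT (fun z : Rn R n * R => (powR z.2 c)%:E).
  apply/measurable_EFinP; apply: (@measurableT_comp _ _ _ _ _ _ (fun t : R => powR t c) _ snd).
    exact: measurable_powR.
  exact: measurable_snd.
apply: emeasurable_funM => //.
apply: (@measurableT_comp _ _ _ _ _ _ (fun t : \bar R => poweR t e)).
  exact: measurable_poweR.
by apply: emeasurable_funM => //; exact: bf_meas.
Qed.

Lemma measurable_wolff_den2 x : measurable_fun setT (h x).
Proof. exact: (measurable_fun_pair2 x measurable_wolff_den). Qed.

Lemma wolff_tail_ge0 x a : 0 <= T x a.
Proof. by apply: integral_ge0 => t _; exact: wolff_den_ge0. Qed.

Lemma wolff_tail_nonincreasing x a b : (a <= b)%R -> T x b <= T x a.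
Proof.
by move=> ab; apply: tail_nonincreasing => //; [exact: measurable_wolff_den2|exact: wolff_den_ge0].
Qed.

Lemma measurable_wolff_tail : measurable_fun setT (fun z : Rn R n * R => T z.1 z.2).
Proof.
pose f (w : (Rn R n * R) * R) := h w.1.1 w.2 *
  (\1_[set w : (Rn R n * R) * R | (w.1.2 < w.2)%R] w)%:E.
have mA : measurable [set w : (Rn R n * R) * R | (w.1.2 < w.2)%R].
  have m2 : measurable_fun setT (fun w : (Rn R n * R) * R => w.1.2).
    by apply: measurableT_comp; [exact: measurable_snd|exact: measurable_fst].
  have := measurable_fun_ltr m2 (@measurable_snd _ _ _ _).
  by move=> /(_ measurableT [set true]); rewrite setTI; apply.
have mf : measurable_fun setT f.
  apply: emeasurable_funM.
    apply: (@measurableT_comp _ _ _ _ _ _ (fun z : Rn R n * R => h z.1 z.2) _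
      (fun w : (Rn R n * R) * R => (w.1.1, w.2))); first exact: measurable_wolff_den.
    apply: measurable_fun_pair => //=.
    by apply: measurableT_comp; [exact: measurable_fst|exact: measurable_fst].
  by apply/measurable_EFinP; exact: measurable_indic.
have f0 w : 0 <= f w by rewrite mule_ge0// wolff_den_ge0.
have := @measurable_fun_fubini_tonelli_F _ _ _ _ _ leb f mf f0.
congr (measurable_fun _ _); apply/funext => -[x t]; rewrite /fubini_F /=.
rewrite /wolff_tail [RHS]integral_mkcond; apply: eq_integral => y _.
rewrite /f/= indicE /patch/=; case: ifPn => yb.
  by rewrite mem_set ?mule1//; rewrite inE in yb.
by rewrite memNset ?mule0//; move=> hh; move/negP: yb; apply; rewrite inE.
Qed.

Lemma measurable_wolff_tail1 a : measurable_fun setT (T ^~ a).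
Proof. exact: (measurable_fun_pair1 a measurable_wolff_tail). Qed.

Lemma wolff_den_dilation (c : R) x t : (0 < c)%R -> (0 < t)%R ->
  h x (c * t)%R =
  (c `^ (- (N * e) - 1))%:E * (poweR (m (eball x (c * t)%R) * ((powR t N)^-1)%:E) e * (t^-1)%:E).
Proof.
move=> c0 t0; rewrite /wolff_den powRM ?(ltW c0) ?(ltW t0)// invfM EFinM.
have bx : 0 <= m (eball x (c * t)%R) by exact: bf_ge0.
rewrite muleCA poweRZl ?invr_ge0 ?powR_ge0//; last first.
  by rewrite mule_ge0 ?lee_fin ?invr_ge0 ?powR_ge0.
rewrite invfM EFinM muleACA -EFinM; congr (_%:E * _).
rewrite -powRN -powRrM mulNr -powR_inv1 ?(ltW c0)// -powRD//.
by rewrite (gt_eqF c0) implybT.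
Qed.

(** B(y, t) lies in B(x, 4 t). The factor 4 is kept apart from 4^(N e) because it is the Jacobian of
    the dilation in [wolff_tail_comparison]. *)
Lemma wolff_den_comparison x y t : (0 < t)%R -> (edist x y <= 3 * t)%R ->
  h y t <= (4 `^ (N * e))%:E * (4%:E * h x (4 * t)%R).
Proof.
move=> t0 xy; rewrite wolff_den_dilation// !muleA -!EFinM.
have -> : (4 `^ (N * e) * 4 * 4 `^ (- (N * e) - 1) = 1 :> R)%R.
  rewrite powRD; last by rewrite pnatr_eq0 implybT.
  rewrite powR_inv1// powRN.
    by have := @powR_gt0 R 4 (N * e); rewrite ltr0n => /(_ isT) h; field; rewrite gt_eqF.
rewrite mul1e; apply: lee_wpmul2r; first by rewrite lee_fin invr_ge0 ltW.
apply: le_poweR; first exact: ltW.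
  by rewrite mule_ge0 ?bf_ge0// lee_fin invr_ge0 powR_ge0.
apply: lee_wpmul2r; first by rewrite lee_fin invr_ge0 powR_ge0.
by apply: bf_le => //; apply: eball_sub; lra.
Qed.

Lemma wolff_tail_comparison x y t : (0 <= t)%R -> (edist x y <= 3 * t)%R ->
  T y t <= (4 `^ (N * e))%:E * T x (4 * t)%R.
Proof.
move=> t0 xy; rewrite /wolff_tail.
rewrite (ge0_integral_dilation _ _ (measurable_wolff_den2 x) (wolff_den_ge0 x))//.
have mdil : measurable_fun setT (fun s : R => h x (4 * s)%R).
  by apply: (measurableT_comp (measurable_wolff_den2 x)); exact: mulrl_measurable.
have mr : measurable (ray t) by exact: measurable_ray.
have m4 : measurable_fun (ray t) (fun s : R => 4%:E * h x (4 * s)%R).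
  by apply: measurable_funeM; exact: measurable_funTS.
have m4' : measurable_fun (ray t) (fun s : R => (4 `^ (N * e))%:E * (4%:E * h x (4 * s)%R)).
  exact: measurable_funeM.
rewrite -ge0_integralZl//; [|exact: measurable_funTS|by move=> *; exact: wolff_den_ge0].
rewrite -ge0_integralZl; [|exact: mr|exact: m4| |by rewrite lee_fin powR_ge0]; last first.
  by move=> s _; rewrite mule_ge0// wolff_den_ge0.
apply: ge0_le_integral; first exact: mr.
- by move=> s _; exact: wolff_den_ge0.
- by apply: measurable_funTS; exact: measurable_wolff_den2.
- exact: m4'.
move=> s ts; apply: wolff_den_comparison; first exact: le_lt_trans ts.
by rewrite (le_trans xy)// ler_pM2l// ltW.
Qed.
End wolff_tail.

(** * A capacity estimate for superlevel sets *)

Section weak_capacity.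
Context (R : realType) (n : nat) (alpha p : R).
Hypotheses (p1 : 1 < p) (alpha0 : 0 < alpha) (alphap : alpha * p < n%:R).
Local Open Scope ereal_scope.
Local Notation leb := (@lebesgue_measure R).
Let N := (n%:R - alpha * p)%R.
Let e := ((p - 1)^-1)%R.
(** Since p' = 1 + e, t^(- kappa) dt is the kernel t^(-(n - alpha) p') dt/t of f^p. *)
Let kappa := ((n%:R - alpha) * (1 + e) + 1)%R.
Let D := (4 `^ (N * e))%R.

Let N0 : (0 < N)%R. Proof. by rewrite subr_gt0. Qed.
Let p0 : (0 < p)%R. Proof. exact: lt_trans p1. Qed.
Let e0 : (0 < e)%R. Proof. by rewrite invr_gt0 subr_gt0. Qed.
Let D1 : (1 <= D)%R.
Proof. by rewrite /D -{1}(powRr0 4); apply: ler_powR; rewrite ?ler1n// mulr_ge0// ltW. Qed.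
Let D0 : (0 < D)%R. Proof. exact: lt_le_trans D1. Qed.
Let pe : (p * e = 1 + e)%R.
Proof. by rewrite /e; field; rewrite subr_eq0 gt_eqF. Qed.
Let nalpha : (alpha < n%:R)%R.
Proof. by apply: lt_trans alphap; rewrite ltr_pMr. Qed.
Let kappa0 : (0 < kappa)%R.
Proof. by rewrite addr_gt0// mulr_gt0 ?subr_gt0// addr_gt0. Qed.
Let nkappa : (n%:R - kappa = - (N * e) - 1)%R.
Proof.
rewrite /kappa /N.
have -> : ((n%:R - alpha * p) * e = n%:R * e - alpha * (p * e))%R by ring.
by rewrite pe; ring.
Qed.

Variable L : {sigma_finite_measure set (Rn R n) -> \bar R}.
Variables (v V : R).
Hypotheses (v0 : (0 < v)%R) (V0 : (0 < V)%R).
Hypothesis ballL : forall x t, (0 < t)%R ->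
  (v * t ^+ n)%:E <= L (eball x t) <= (V * t ^+ n)%:E.

Variable mu : {sigma_finite_measure set (Rn R n) -> \bar R}.
Local Notation h := (wolff_den N e mu).
Local Notation T := (wolff_tail N e mu).
Hypothesis muT : mu setT < +oo.
Hypothesis Tfin : forall x a, (0 < a)%R -> T x a < +oo.
Variable lam : R.
Hypothesis lam0 : (0 < lam)%R.

Let bm := ball_function_measure mu.

(** C is the cutoff in the definition of f, already one factor D wider than the window from lam to 2
    lam used at x. C' is what C at (y, t) implies for a centre z with |y - z| < 2 t, after a second
    factor D. *)
Let C : set (Rn R n * R) := [set z | [/\ (0 < z.2)%R, (lam / D)%:E <= T z.1 z.2
  & T z.1 z.2 <= (2 * D * lam)%:E]].
Let C' : set (Rn R n * R) := [set z | [/\ (0 < z.2)%R, (lam / (D ^+ 2))%:E <= T z.1 0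
  & T z.1 (4 * z.2)%R <= (2 * D ^+ 2 * lam)%:E]].

Let measurable_C : measurable C.
Proof.
have -> : C = [set z | (0 < z.2)%R] `&` ([set z | (lam / D)%:E <= T z.1 z.2]
    `&` [set z | T z.1 z.2 <= (2 * D * lam)%:E]).
  by apply/seteqP; split => [z []//|z [? []]].
apply: measurableI; last apply: measurableI.
- have := measurable_fun_ltr (@measurable_cst _ _ (Rn R n * R)%type R setT 0%R) (@measurable_snd _ _ (Rn R n) R).
  by move=> /(_ measurableT [set true]); rewrite setTI; apply.
- rewrite -[X in measurable X]setTI; apply: measurable_lee => //.
  exact: measurable_wolff_tail.
- rewrite -[X in measurable X]setTI; apply: measurable_lee => //.
  exact: measurable_wolff_tail.
Qed.

Let measurable_C' : measurable C'.
Proof.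
have -> : C' = [set z | (0 < z.2)%R] `&` ([set z | (lam / D ^+ 2)%:E <= T z.1 0]
    `&` [set z | T z.1 (4 * z.2)%R <= (2 * D ^+ 2 * lam)%:E]).
  by apply/seteqP; split => [z []//|z [? []]].
have mT4 : measurable_fun setT (fun z : Rn R n * R => T z.1 (4 * z.2)%R).
  apply: (@measurableT_comp _ _ _ _ _ _ (fun z : Rn R n * R => T z.1 z.2) _
    (fun z : Rn R n * R => (z.1, (4 * z.2)%R))).
    exact: measurable_wolff_tail.
  by apply: measurable_fun_pair => //; exact: measurable_funM.
apply: measurableI; last apply: measurableI.
- have := measurable_fun_ltr (@measurable_cst _ _ (Rn R n * R)%type R setT 0%R) (@measurable_snd _ _ (Rn R n) R).
  by move=> /(_ measurableT [set true]); rewrite setTI; apply.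
- rewrite -[X in measurable X]setTI; apply: measurable_lee => //.
  apply: (@measurableT_comp _ _ _ _ _ _ (fun y : Rn R n => T y 0%R)).
    exact: measurable_wolff_tail1.
  exact: measurable_fst.
- by rewrite -[X in measurable X]setTI; apply: measurable_lee.
Qed.

(** The integrand [Phi] of f^p is a weight W times one more factor mu(B(y, 2 t)), which Tonelli's
    theorem unfolds as an integral over z. W' dominates W once the centre has moved to z. *)
Let W (z : Rn R n * R) := (\1_C z)%:E * (poweR (mu (eball z.1 (2 * z.2)%R)) e * (powR z.2 (- kappa))%:E).
Let W' (z : Rn R n * R) := (\1_C' z)%:E * (poweR (mu (eball z.1 (4 * z.2)%R)) e * (powR z.2 (- kappa))%:E).
Let Phi z := W z * mu (eball z.1 (2 * z.2)%R).
Let Psi (z : Rn R n * R) := (\1_C' z)%:E * h z.1 (4 * z.2)%R.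
Let F y := \int[leb]_t Phi (y, t).

Let measurable_mu_ball (k : R) : measurable_fun setT (fun z : Rn R n * R => mu (eball z.1 (k * z.2)%R)).
Proof.
apply: (@measurableT_comp _ _ _ _ _ _ (fun z : Rn R n * R => mu (eball z.1 z.2)) _
    (fun z : Rn R n * R => (z.1, (k * z.2)%R))).
  exact: bf_meas.
by apply: measurable_fun_pair => //; exact: measurable_funM.
Qed.

Let measurable_factor (k : R) : measurable_fun setT
  (fun z : Rn R n * R => poweR (mu (eball z.1 (k * z.2)%R)) e * (powR z.2 (- kappa))%:E).
Proof.
apply: emeasurable_funM.
  apply: (@measurableT_comp _ _ _ _ _ _ (fun t : \bar R => poweR t e)).
    exact: measurable_poweR.
  exact: measurable_mu_ball.
apply/measurable_EFinP; apply: (@measurableT_comp _ _ _ _ _ _ (fun t : R => powR t (- kappa)) _ snd).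
  exact: measurable_powR.
exact: measurable_snd.
Qed.

Let measurable_W : measurable_fun setT W.
Proof. by apply: emeasurable_funM => //; apply/measurable_EFinP; exact: measurable_indic. Qed.
Let measurable_W' : measurable_fun setT W'.
Proof. by apply: emeasurable_funM => //; apply/measurable_EFinP; exact: measurable_indic. Qed.
Let measurable_Phi : measurable_fun setT Phi.
Proof. exact: emeasurable_funM. Qed.
Let measurable_Psi : measurable_fun setT Psi.
Proof.
apply: emeasurable_funM; first by apply/measurable_EFinP; exact: measurable_indic.
apply: (@measurableT_comp _ _ _ _ _ _ (fun z : Rn R n * R => h z.1 z.2) _
    (fun z : Rn R n * R => (z.1, (4 * z.2)%R))).
  exact: measurable_wolff_den.
by apply: measurable_fun_pair => //; exact: measurable_funM.
Qed.
Let W_ge0 z : 0 <= W z.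
Proof. by rewrite mule_ge0// mule_ge0 ?poweR_ge0// lee_fin powR_ge0. Qed.
Let W'_ge0 z : 0 <= W' z.
Proof. by rewrite mule_ge0// mule_ge0 ?poweR_ge0// lee_fin powR_ge0. Qed.
Let Phi_ge0 z : 0 <= Phi z.
Proof. exact: mule_ge0. Qed.
Let Psi_ge0 z : 0 <= Psi z.
Proof. by rewrite mule_ge0// wolff_den_ge0. Qed.

Let W_le (y z : Rn R n) (t : R) : (edist y z < 2 * t)%R -> W (y, t) <= W' (z, t).
Proof.
move=> yz; have t0 : (0 < t)%R.
  by have := le_lt_trans (Rn_dist_ge0 y z) yz; rewrite pmulr_rgt0.
rewrite /W /W' !indicE; case: (boolP ((y, t) \in C)) => [|_]; last first.
  by rewrite mul0e mule_ge0// mule_ge0 ?poweR_ge0// lee_fin powR_ge0.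
rewrite inE => -[_ /= Ta Tb].
rewrite mem_set/=; last first.
  split => //=.
    have h1 : T y t <= D%:E * T z 0%R.
      apply: (@le_trans _ _ (D%:E * T z (4 * t)%R)); last first.
        apply: lee_wpmul2l; [by rewrite lee_fin ltW|apply: wolff_tail_nonincreasing => //].
        by rewrite mulr_ge0// ltW.
      apply: (wolff_tail_comparison N e0 bm); first exact: ltW.
      by rewrite Rn_distC; apply: le_trans (ltW yz) _; rewrite ler_pM2r// ler_nat.
    have := le_trans Ta h1; rewrite muleC -lee_pdivrMr// -EFinM.
    by rewrite expr2 invfM mulrA.
  have h1 : T z (4 * t)%R <= D%:E * T y t.
    apply: le_trans (wolff_tail_nonincreasing N e0 bm z (_ : (t <= 4 * t)%R)) _.
      by rewrite ler_peMl ?ler1n// ltW.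
    apply: (@le_trans _ _ (D%:E * T y (4 * t)%R)); last first.
      apply: lee_wpmul2l; [by rewrite lee_fin ltW|apply: wolff_tail_nonincreasing => //].
      by rewrite ler_peMl ?ler1n// ltW.
    apply: (wolff_tail_comparison N e0 bm); first exact: ltW.
    by apply: le_trans (ltW yz) _; rewrite ler_pM2r// ler_nat.
  apply: le_trans h1 _; apply: le_trans (lee_wpmul2l _ Tb) _; first by rewrite lee_fin ltW.
  by rewrite -EFinM lee_fin expr2 le_eqVlt; apply/orP; left; apply/eqP; ring.
rewrite !mul1e; apply: lee_wpmul2r; first by rewrite lee_fin powR_ge0.
apply: le_poweR; [exact: ltW|exact: measure_ge0|].
apply: bf_le => //; apply: eball_sub; rewrite Rn_distC; lra.
Qed.

(** A count of exponents: n - kappa = - N e - 1, so weight times volume is a multiple of the Wolff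
    density at radius 4 t. *)
Let scale_identity (z : Rn R n) (t : R) : (0 < t)%R ->
  (poweR (mu (eball z (4 * t)%R)) e * (powR t (- kappa))%:E) * (V * (2 * t) ^+ n)%:E =
  (V * 2 ^+ n * 4 `^ (N * e + 1))%:E * h z (4 * t)%R.
Proof.
move=> t0; rewrite (wolff_den_dilation N e bm z (ltr0n R 4) t0).
set M := mu _; have M0 : 0 <= M by exact: measure_ge0.
rewrite [(M * _)%E]muleC poweRZl ?invr_ge0 ?powR_ge0//.
move: (poweR M e) => X; rewrite [(_%:E * X)%E]muleC -!muleA -!EFinM.
rewrite (muleCA _ X) -EFinM (muleCA _ X) -EFinM; congr (_ * _%:E).
rewrite exprMn -(@powR_mulrn _ t) ?(ltW t0)//.
have -> : (t `^ (- kappa) * (V * (2 ^+ n * t `^ n%:R)) = V * 2 ^+ n * t `^ (- (N * e) - 1))%R.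
  rewrite -nkappa powRD; last by rewrite (gt_eqF t0) implybT.
  by ring.
have -> : (- (N * e) - 1 = - (N * e + 1))%R by ring.
rewrite -(powRN t N) -powRrM mulNr -(powR_inv1 (ltW t0)) -powRD; last by rewrite (gt_eqF t0) implybT.
have -> : (- (N * e) + -1 = - (N * e + 1))%R by ring.
by rewrite (powRN 4); field; rewrite gt_eqF// powR_gt0.
Qed.

(** At fixed t the integrals over |y - z| < 2 t are exchanged. Once W is replaced by W', the
    integrand depends on y only through B(z, 2 t), whose volume [ballL] bounds. *)
Let slice_le t : \int[L]_y Phi (y, t) <=
  (V * 2 ^+ n * 4 `^ (N * e + 1))%:E * \int[mu]_z Psi (z, t).
Proof.
have [t0|t0] := leP t 0%R.
  rewrite integral0_eq; last first.
    move=> y _; rewrite /Phi /W indicE memNset ?mul0e//= => -[/= /lt_le_trans -/(_ _ t0)].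
    by rewrite ltxx.
  rewrite mule_ge0 ?integral_ge0// lee_fin !mulr_ge0 ?powR_ge0//; exact: ltW.
pose B := [set w : Rn R n * Rn R n | (edist w.1 w.2 < 2 * t)%R].
have mB : measurable B.
  have := measurable_fun_ltr (@measurable_Rn_dist R n) (@measurable_cst _ _ (Rn R n * Rn R n)%type R setT (2 * t)%R).
  by move=> /(_ measurableT [set true]); rewrite setTI; apply.
pose f (w : Rn R n * Rn R n) := W (w.1, t) * (\1_B w)%:E.
pose g (w : Rn R n * Rn R n) := W' (w.2, t) * (\1_B w)%:E.
have mW1 : measurable_fun setT (fun y => W (y, t)) by exact: measurable_fun_pair1.
have mW'1 : measurable_fun setT (fun y => W' (y, t)) by exact: measurable_fun_pair1.
have m1B : measurable_fun setT (fun w => (\1_B w)%:E : \bar R).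
  by apply/measurable_EFinP; exact: measurable_indic.
have mf : measurable_fun setT f.
  by apply: emeasurable_funM => //; apply: (@measurableT_comp _ _ _ _ _ _ (fun y => W (y, t)) _ fst).
have mg : measurable_fun setT g.
  by apply: emeasurable_funM => //; apply: (@measurableT_comp _ _ _ _ _ _ (fun y => W' (y, t)) _ snd).
have f0 w : 0 <= f w by rewrite mule_ge0.
have g0 w : 0 <= g w by rewrite mule_ge0.
have mB1 y : measurable [set z | B (y, z)].
  by have := measurable_xsection y mB; congr measurable; apply/seteqP; split => z; rewrite /xsection/= inE.
have mB2 z : measurable [set y | B (y, z)].
  by have := measurable_ysection z mB; congr measurable; apply/seteqP; split => y; rewrite /ysection/= inE.
have -> : \int[L]_y Phi (y, t) = \int[L]_y \int[mu]_z f (y, z).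
  apply: eq_integral => y _; rewrite /f/= ge0_integralZl//; last first.
    exact: (measurable_fun_pair2 y m1B).
  congr (_ * _); rewrite (_ : (fun z => _) = (fun z => (\1_[set z | B (y, z)] z)%:E)).
    by rewrite integral_indic// setIT.
  by apply/funext => z; rewrite !indicE; congr ((nat_of_bool _)%:R%:E); apply/idP/idP; rewrite !inE.
rewrite fubini_tonelli//.
apply: (@le_trans _ _ (\int[mu]_z \int[L]_y g (y, z))).
  apply: ge0_le_integral => //.
  - by move=> z _; exact: integral_ge0.
  - exact: measurable_fun_fubini_tonelli_G.
  - exact: measurable_fun_fubini_tonelli_G.
  move=> z _; apply: ge0_le_integral => //.
  - exact: measurable_fun_pair1.
  - exact: measurable_fun_pair1.
  move=> y _; rewrite /f /g/= indicE; case: (boolP ((y, z) \in B)); last by rewrite !mule0.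
  by rewrite inE /B/= !mule1 => yz; exact: W_le.
rewrite -ge0_integralZl//; last 2 first.
- by move=> *; exact: measurable_fun_pair1.
- by rewrite lee_fin !mulr_ge0 ?powR_ge0//; exact: ltW.
apply: ge0_le_integral => //.
- by move=> z _; exact: integral_ge0.
- exact: measurable_fun_fubini_tonelli_G.
- by apply: measurable_funeM; exact: measurable_fun_pair1.
move=> z _; rewrite /g/= ge0_integralZl//; last exact: (measurable_fun_pair1 z m1B).
rewrite (_ : (fun y => _) = (fun y => (\1_(eball z (2 * t)%R) y)%:E)); last first.
  by apply/funext => y; rewrite !indicE; congr ((nat_of_bool _)%:R%:E); apply/idP/idP; rewrite !inE /B/eball/= Rn_distC.
rewrite integral_indic ?setIT//; last exact: measurable_eball.
have /andP[_ Lb] := ballL z (mulr_gt0 (ltr0n R 2) t0 : (0 < 2 * t)%R).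
apply: le_trans (lee_wpmul2l _ Lb) _ => //.
by rewrite /W' /Psi -muleA [leRHS]muleCA; apply: lee_wpmul2l => //; rewrite scale_identity.
Qed.


Let M := (2 * D ^+ 2 * lam)%R.
Let M0 : (0 < M)%R. Proof. by rewrite !mulr_gt0// exprn_gt0. Qed.
Let G : set (Rn R n) := [set z | (lam / D ^+ 2)%:E <= T z 0].
Let measurable_G : measurable G.
Proof.
rewrite -[X in measurable X]setTI; apply: measurable_lee => //.
exact: measurable_wolff_tail1.
Qed.

(** C' leaves only z in G and only radii 4 t with T_z(4 t) <= M, whose mass is at most M; the 1/4 is
    the Jacobian of t -> 4 t. *)
Let Psi_le z : \int[leb]_t Psi (z, t) <= (M / 4)%:E * (\1_G z)%:E.
Proof.
have [zG|zG] := pselect (G z); last first.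
  rewrite integral0_eq ?mule_ge0// ?lee_fin ?divr_ge0 ?(ltW M0)// => t _.
  by rewrite /Psi indicE memNset ?mul0e// => -[].
have -> : (\1_G z = 1 :> R)%R by rewrite indicE mem_set.
rewrite mule1.
pose S := low_tail (h z) 0 M%:E.
have mh := measurable_wolff_den2 N e0 bm z.
have h0 := wolff_den_ge0 N e0 bm z.
have mS : measurable S by exact: measurable_low_tail.
pose h' s := h z s * (\1_S s)%:E.
have mh' : measurable_fun setT h'.
  by apply: emeasurable_funM => //; apply/measurable_EFinP; exact: measurable_indic.
have h'0 s : 0 <= h' s by rewrite mule_ge0.
have -> : \int[leb]_t Psi (z, t) = \int[leb]_(t in ray 0%R) h' (4 * t)%R.
  rewrite [RHS]integral_mkcond; apply: eq_integral => t _; rewrite /patch.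
  case: ifPn => [|]; rewrite ?inE /ray/= => t0.
    rewrite /Psi /h' muleC; congr (_ * _%:E); rewrite !indicE; congr ((nat_of_bool _)%:R).
    apply/idP/idP; rewrite !inE; first by move=> -[_ _ ?]; split => //; rewrite mulr_gt0.
    by move=> -[_ ?]; split.
  rewrite /Psi indicE memNset ?mul0e//= => -[/= t0' _ _].
  by move/negP: t0; apply; rewrite inE.
rewrite EFinM muleC lee_pdivlMl//.
rewrite -(ge0_integral_dilation 0 (ltr0n R 4) mh' h'0) mulr0.
apply: le_trans (integral_low_tail_le mh h0 0 (ltW M0 : 0 <= M%:E)).
rewrite [leRHS]integral_mkcond [leLHS]integral_mkcond; apply: ge0_le_integral => //.
- by move=> t _; apply: erestrict_ge0 => *; exact: h'0.
- by apply/(measurable_restrictT _ (measurable_ray _)); exact: measurable_funTS.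
- by apply/(measurable_restrictT _ mS); exact: measurable_funTS.
move=> t _; rewrite /patch /h' indicE; case: (t \in S); rewrite ?mule1 ?mule0//.
  by case: ifP.
by case: ifP.
Qed.

Let F_ge0 y : 0 <= F y. Proof. exact: integral_ge0. Qed.
Let measurable_F : measurable_fun setT F.
Proof. exact: measurable_fun_fubini_tonelli_F. Qed.

Let c2 := (V * 2 ^+ n * 4 `^ (N * e + 1))%R.
Let c20 : (0 < c2)%R.
Proof. by rewrite !mulr_gt0 ?powR_gt0// exprn_gt0. Qed.

Let integral_F_le : \int[L]_y F y <= (c2 * (M / 4))%:E * mu G.
Proof.
rewrite [leLHS](_ : _ = \int[leb]_t \int[L]_y Phi (y, t)); last first.
  exact: fubini_tonelli.
apply: (@le_trans _ _ (\int[leb]_t (c2%:E * \int[mu]_z Psi (z, t)))).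
  apply: ge0_le_integral => //.
  - by move=> t _; exact: integral_ge0.
  - exact: measurable_fun_fubini_tonelli_G.
  - by apply: measurable_funeM; exact: measurable_fun_fubini_tonelli_G.
rewrite ge0_integralZl//; last 3 first.
- exact: measurable_fun_fubini_tonelli_G.
- by move=> t _; exact: integral_ge0.
- by rewrite lee_fin ltW.
rewrite (EFinM c2) -[leRHS]muleA; apply: lee_wpmul2l; first by rewrite lee_fin ltW.
rewrite [X in X <= _](_ : _ = \int[mu]_z \int[leb]_t Psi (z, t)); last first.
  exact/esym/fubini_tonelli.
have m1G : measurable_fun setT (fun z => (\1_G z)%:E : \bar R).
  by apply/measurable_EFinP; exact: measurable_indic.
apply: (@le_trans _ _ (\int[mu]_z ((M / 4)%:E * (\1_G z)%:E))).
  apply: ge0_le_integral => //.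
  - by move=> t _; exact: integral_ge0.
  - exact: measurable_fun_fubini_tonelli_F.
  - exact: measurable_funeM.
rewrite ge0_integralZl//; first by rewrite integral_indic// setIT.
by rewrite lee_fin divr_ge0// ltW.
Qed.

(** For t < s <= 2 t the pair (y, s) lies in C and B(x, t) is contained in B(y, 2 s); integrating
    over this interval of length t gives the bound. *)
Let F_lower (x y : Rn R n) (t : R) : (0 < t)%R -> (edist x y < t)%R -> lam%:E <= T x t ->
  T x t <= (2 * lam)%:E ->
  (poweR (mu (eball x t)) e * mu (eball x t)) * (t * (2 * t) `^ (- kappa))%:E <= F y.
Proof.
move=> t0 xy Tl Tu; set c := poweR _ _ * _.
have c0 : 0 <= c by rewrite mule_ge0 ?poweR_ge0.
have mI : measurable (`]t, (2 * t)%R]%classic : set R) by exact: measurable_itv.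
apply: (@le_trans _ _ (\int[leb]_(s in `]t, (2 * t)%R]) (c * ((2 * t) `^ (- kappa))%:E))).
  have hl : leb (`]t, (2 * t)%R]%classic : set R) = t%:E.
    rewrite lebesgue_measure_itv/= lte_fin ltr_pMl ?ltr1n//.
    by rewrite -EFinB; congr (_%:E); ring.
  apply: (@le_trans _ _ (c * ((2 * t) `^ (- kappa))%:E * leb (`]t, (2 * t)%R]%classic : set R))).
    by rewrite hl -[leRHS]muleA -EFinM [in leRHS]mulrC.
  by rewrite integral_cst.
rewrite integral_mkcond; apply: ge0_le_integral => //.
- move=> s _; apply: erestrict_ge0 => *; rewrite mule_ge0// lee_fin powR_ge0//.
- by apply/(measurable_restrictT _ mI); exact: measurable_cst.
- exact: (measurable_fun_pair2 y measurable_Phi).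
move=> s _; rewrite /patch; case: ifPn => //; rewrite inE/= in_itv/= => /andP[ts st].
have s0 : (0 < s)%R by exact: lt_trans ts.
rewrite /Phi /W indicE mem_set/=; last first.
  split => //=.
    rewrite (_ : (lam / D)%:E = (D^-1)%:E * lam%:E); last by rewrite -EFinM mulrC.
    (* The comparison starts from radius t/2 because 4 (t/2) = 2 t still dominates s, while |x - y|
       < t stays below 3 (t/2). *)
    rewrite lee_pdivrMl//; apply: le_trans Tl _; apply: (@le_trans _ _ (T x (t / 2))).
      by apply: wolff_tail_nonincreasing => //; lra.
    apply: (@le_trans _ _ (D%:E * T y (4 * (t / 2))%R)).
      by apply: wolff_tail_comparison => //; [lra|rewrite Rn_distC; lra].
    apply: lee_wpmul2l; first by rewrite lee_fin ltW.
    by apply: wolff_tail_nonincreasing => //; lra.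
  apply: (@le_trans _ _ (D%:E * T x t)); last first.
    apply: le_trans (lee_wpmul2l _ Tu) _; first by rewrite lee_fin ltW.
    by rewrite -EFinM lee_fin mulrCA mulrA.
  apply: (@le_trans _ _ (T y t)); first by apply: wolff_tail_nonincreasing => //; exact: ltW.
  apply: (@le_trans _ _ (D%:E * T x (4 * t)%R)).
    by apply: wolff_tail_comparison => //; lra.
  apply: lee_wpmul2l; first by rewrite lee_fin ltW.
  by apply: wolff_tail_nonincreasing => //; lra.
have mub : mu (eball x t) <= mu (eball y (2 * s)%R).
  by apply: bf_le => //; apply: eball_sub; rewrite Rn_distC; lra.
rewrite mul1e /c muleAC; apply: lee_pmul => //.
  by rewrite mule_ge0 ?poweR_ge0// lee_fin powR_ge0.
apply: lee_pmul; [exact: poweR_ge0|by rewrite lee_fin powR_ge0|by apply: le_poweR => //; exact: ltW|].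
rewrite lee_fin !powRN lef_pV2 ?posrE ?powR_gt0 ?mulr_gt0//.
by apply: ge0_ler_powR; rewrite ?nnegrE ?(ltW kappa0) ?(ltW s0)// mulr_ge0// ltW.
Qed.

(** The volume constant times the p-th root of the 2^(- kappa) from [F_lower]; this choice makes
    [integrand_identity] an equality. *)
Let c1 := (v * 2 `^ (- (kappa / p)))%R.
Let c10 : (0 < c1)%R. Proof. by rewrite mulr_gt0// powR_gt0. Qed.
(** [cap_admissible] asks for a real-valued function. [fine] sends an infinite F to 0, which is
    harmful only on a null set by [F_ae]; hence the almost-everywhere comparison in
    [inner_lower]. *)
Let f y := (fine (F y) `^ p^-1 / (c1 * lam))%R.
Let f_ge0 y : (0 <= f y)%R.
Proof. by rewrite divr_ge0 ?powR_ge0 ?mulr_ge0 ?ltW. Qed.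
Let measurable_f : measurable_fun setT f.
Proof.
apply: measurable_funM => //.
apply: (@measurableT_comp _ _ _ _ _ _ (fun t : R => powR t p^-1)).
  exact: measurable_powR.
exact: measurableT_comp.
Qed.

Let f_powR y : ((`|f y| `^ p)%:E <= ((c1 * lam) `^ (- p))%:E * F y)%E.
Proof.
rewrite ger0_norm// /f powRM; [|exact: powR_ge0|by rewrite invr_ge0 mulr_ge0// ltW].
rewrite -powRrM mulVf ?gt_eqF// powRr1; last exact: fine_ge0.
rewrite mulrC EFinM -(powR_inv1 (ltW (mulr_gt0 c10 lam0))) -powRrM mulN1r.
apply: lee_wpmul2l; first by rewrite lee_fin powR_ge0.
by have := F_ge0 y; case: (F y) => [z| |]//= _; rewrite leey.
Qed.

Let f_norm_le : \int[L]_y (`|f y| `^ p)%:E <=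
  ((c1 * lam) `^ (- p) * (c2 * (M / 4)))%:E * mu G.
Proof.
apply: (@le_trans _ _ (((c1 * lam) `^ (- p))%:E * \int[L]_y F y)); last first.
  by rewrite EFinM -muleA; apply: lee_wpmul2l integral_F_le; rewrite lee_fin powR_ge0.
rewrite -ge0_integralZl//; last by rewrite lee_fin powR_ge0.
apply: ge0_le_integral => //.
- apply/measurable_EFinP; apply: (@measurableT_comp _ _ _ _ _ _ (fun t : R => powR t p)).
    exact: measurable_powR.
  by apply: measurableT_comp => //.
- exact: measurable_funeM.
Qed.

(** The exponent of m is p'/p = e, and that of t is (1 - kappa)/p + n - (n - alpha) - 1 = - N e -
    1. *)
Let integrand_identity (m t : R) : (0 <= m)%R -> (0 < t)%R ->
  (((m `^ e * m * (t * (2 * t) `^ (- kappa))) `^ p^-1 / (c1 * lam)) * (v * t ^+ n) *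
    ((t `^ (n%:R - alpha))^-1 * t^-1) = ((m * (t `^ N)^-1) `^ e * t^-1) / lam)%R.
Proof.
move=> m0 t0.
have t0' : t != 0%R by rewrite gt_eqF.
have -> : (m `^ e * m = m `^ (p * e))%R.
  rewrite pe powRD ?powRr1//; first by rewrite mulrC.
  by rewrite gt_eqF// addr_gt0.
have -> : (t * (2 * t) `^ (- kappa) = 2 `^ (- kappa) * t `^ (1 - kappa))%R.
  rewrite powRM// ?(ltW t0)// mulrCA; congr (_ * _)%R.
  by rewrite powRD ?powRr1 ?(ltW t0)// t0' implybT.
rewrite powRM ?powR_ge0 ?mulr_ge0 ?powR_ge0//.
rewrite powRM ?powR_ge0// -!powRrM.
rewrite (_ : p * e / p = e)%R; last by field; rewrite gt_eqF.
rewrite [in RHS]powRM ?invr_ge0 ?powR_ge0// -(powRN t N) -powRrM.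
rewrite -(powRN t (n%:R - alpha)) -(@powR_mulrn _ t) ?(ltW t0)// -(powR_inv1 (ltW t0)).
rewrite /c1.
have c20' : (2 `^ (- (kappa / p)) != 0 :> R)%R by rewrite gt_eqF// powR_gt0.
have -> : (- kappa / p = - (kappa / p))%R by rewrite mulNr.
have -> : (t `^ (- N * e) = t `^ ((1 - kappa) / p) * t `^ n%:R * t `^ (- (n%:R - alpha)))%R.
  rewrite -powRD ?t0' ?implybT// -powRD ?t0' ?implybT//; congr (_ `^ _)%R.
  rewrite /N /kappa -pe; have := pe; move: p0 => pp0 peq.
  have -> : (- (n%:R - alpha * p) * e = - (n%:R * e) + alpha * (p * e))%R by ring.
  have -> : ((1 - ((n%:R - alpha) * (p * e) + 1)) / p = - (n%:R - alpha) * e)%R.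
    by field; rewrite gt_eqF.
  by rewrite peq; ring.
by field; rewrite c20' !gt_eqF.
Qed.

Variable LE : (L = @lebesgueRn R n :> (set (Rn R n) -> \bar R)).

Let F_ae : \int[L]_y F y < +oo -> {ae L, forall y, F y \is a fin_num}.
Proof.
move=> Ffin; have /integrable_ae : L.-integrable setT F.
  apply/integrableP; split => //.
  by under eq_integral do rewrite gee0_abs//.
by move=> /(_ measurableT); apply: filterS => y; exact.
Qed.

Let inner_lower (x : Rn R n) (t : R) : \int[L]_y F y < +oo -> (0 < t)%R -> lam%:E <= T x t ->
  T x t <= (2 * lam)%:E ->
  (lam^-1)%:E * h x t <=
    (\int[L]_(y in eball x t) (f y)%:E) * ((t `^ (n%:R - alpha))^-1 * t^-1)%:E.
Proof.
move=> Ffin t0 Tl Tu.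
have mfin : mu (eball x t) \is a fin_num.
  rewrite ge0_fin_numE//; apply: le_lt_trans muT; apply: le_measure => //; rewrite inE//.
  exact: measurable_eball.
set m := fine (mu (eball x t)).
have mE : mu (eball x t) = m%:E by rewrite fineK.
have m0 : (0 <= m)%R by exact: fine_ge0.
have -> : h x t = ((m * (t `^ N)^-1) `^ e * t^-1)%:E by rewrite /wolff_den mE.
rewrite -EFinM mulrC -integrand_identity//.
rewrite EFinM; apply: lee_wpmul2r.
  by rewrite lee_fin mulr_ge0 ?invr_ge0 ?powR_ge0// ltW.
set g := (_ / _)%R.
have g0 : (0 <= g)%R by rewrite divr_ge0 ?powR_ge0// mulr_ge0 ?ltW.
have mB := measurable_eball x t.
apply: (@le_trans _ _ (\int[L]_(y in eball x t) g%:E)).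
  rewrite integral_cst// EFinM; apply: lee_wpmul2l; first by rewrite lee_fin.
  by have /andP[] := ballL x t0.
apply: ae_ge0_le_integral => //.
- by move=> y _; rewrite lee_fin.
- by apply: measurable_funTS; apply/measurable_EFinP.
apply: filterS (F_ae Ffin) => y Fy xy; rewrite lee_fin /g /f ler_pM2r ?invr_gt0 ?mulr_gt0//.
apply: ge0_ler_powR; rewrite ?nnegrE ?invr_ge0 ?(ltW p0) ?fine_ge0//.
  by rewrite mulr_ge0 ?mulr_ge0 ?powR_ge0 ?(ltW t0).
rewrite -lee_fin fineK//; apply: le_trans (F_lower t0 xy Tl Tu).
by rewrite mE poweR_EFin -!EFinM.
Qed.

(** f is admissible: at x in E the radii with T_x between lam and 2 lam carry mass at least lam, and
    there [inner_lower] puts h / lam below the integrand of I_alpha f. *)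
Lemma cap_superlevel_le (E : set (Rn R n)) : (forall x, E x -> (2 * lam)%:E < T x 0) ->
  cap alpha p E <=
  ((v * 2 `^ (- (kappa / p)) * lam) `^ (- p) *
   (V * 2 ^+ n * 4 `^ (N * e + 1) * (2 * D ^+ 2 * lam / 4)))%:E *
  mu [set z | (lam / D ^+ 2)%:E <= T z 0].
Proof.
move=> HE.
have Ffin : \int[L]_y F y < +oo.
  apply: le_lt_trans integral_F_le _; apply: lte_mul_pinfty => //.
    by rewrite lee_fin mulr_ge0 ?divr_ge0 ?ltW.
  by apply: le_lt_trans muT; apply: le_measure => //; rewrite inE.
apply: le_trans f_norm_le; rewrite LE; apply: ereal_inf_lbound; exists f => //.
split => //.
  rewrite -LE; apply: le_lt_trans f_norm_le _; apply: lte_mul_pinfty => //.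
    by rewrite lee_fin mulr_ge0 ?powR_ge0// mulr_ge0 ?divr_ge0 ?ltW.
  by apply: le_lt_trans muT; apply: le_measure => //; rewrite inE.
move=> x /HE Tx; rewrite /Ialpha -LE.
have mh := measurable_wolff_den2 N e0 bm x.
have h0 := wolff_den_ge0 N e0 bm x.
(* T_x(0) may be infinite; at a positive radius the tail is finite, as [integral_low_tail_ge]
   requires, and still exceeds 2 lam. *)
have [a a0 Ta] := integral_ray_gt mh h0 Tx.
pose S1 := low_tail (h x) a (2 * lam)%:E; pose S2 := low_tail (h x) a lam%:E.
have S1ge : (2 * lam)%:E <= \int[leb]_(t in S1) h x t.
  by apply: integral_low_tail_ge => //; [exact: Tfin|rewrite mulr_ge0// ltW].
have S2le : \int[leb]_(t in S2) h x t <= lam%:E.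
  by apply: integral_low_tail_le => //; rewrite lee_fin ltW.
have mS1 : measurable S1 by exact: measurable_low_tail.
have mS2 : measurable S2 by exact: measurable_low_tail.
have S21 : S2 `<=` S1.
  by move=> t [at_ Tt]; split => //; apply: le_trans Tt _; rewrite lee_fin ler_peMl ?ler1n ?ltW.
have mS : measurable (S1 `\` S2) by exact: measurableD.
have Sge : lam%:E <= \int[leb]_(t in S1 `\` S2) h x t.
  have : \int[leb]_(t in S1) h x t = \int[leb]_(t in S2) h x t + \int[leb]_(t in S1 `\` S2) h x t.
    rewrite -ge0_integral_setU//; [by rewrite setDUK|exact: measurable_funTS|].
    by rewrite disj_set2E setDIK.
  move=> E1; move: S1ge; rewrite E1 => /le_trans /(_ (leeD2r _ S2le)).
  by rewrite -leeBlDl// -EFinB; congr (_%:E <= _); ring.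
have mB : measurable_fun setT (fun t : R => \int[L]_(y in eball x t) (f y)%:E).
  have bf := ball_function_density L (proj2 (measurable_EFinP _ _) measurable_f)
    (fun y => f_ge0 y : 0 <= (f y)%:E).
  exact: (measurable_fun_pair2 x (bf_meas bf)).
have mray : measurable [set r : R | (0 < r)%R] by exact: measurable_ray.
apply: (@le_trans _ _ (\int[leb]_(t in S1 `\` S2) ((lam^-1)%:E * h x t))).
  rewrite ge0_integralZl//; [|exact: measurable_funTS|by rewrite lee_fin invr_ge0 ltW].
  by rewrite lee_pdivlMl// mule1.
rewrite integral_mkcond [leRHS]integral_mkcond; apply: ge0_le_integral => //.
- by move=> t _; apply: erestrict_ge0 => s _; rewrite mule_ge0// lee_fin invr_ge0 ltW.
- apply/(measurable_restrictT _ mS); apply: measurable_funTS; exact: measurable_funeM.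
- apply/(measurable_restrictT _ mray).
  apply: (@eq_measurable_fun _ _ _ _ _ (fun t : R => (\int[L]_(y in eball x t) (f y)%:E) *
     (t `^ (- (n%:R - alpha)) * t `^ (-1))%:E)).
    by move=> t; rewrite inE/= => t0; rewrite powRN powR_inv1// ltW.
  apply: measurable_funTS; apply: emeasurable_funM => //.
  apply/measurable_EFinP; apply: measurable_funM; exact: measurable_powR.
move=> t _; rewrite /patch; case: ifPn => [|_]; last first.
  case: ifPn => //; rewrite inE/= => t0; rewrite mule_ge0 ?integral_ge0//.
    by move=> y _; rewrite lee_fin.
  by rewrite lee_fin mulr_ge0 ?invr_ge0 ?powR_ge0 ?ltW.
rewrite inE => -[[at_ Tt] nS2].
have t0 : (0 < t)%R by exact: lt_trans at_.
rewrite mem_set//; apply: inner_lower => //.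
by rewrite leNgt; apply/negP => Tl; apply: nS2; split => //; exact: ltW.
Qed.
End weak_capacity.

(** * From capacities to measures *)

Section tail_finite.
Context (R : realType) (n : nat) (N e : R).
Hypotheses (N0 : 0 < N) (e0 : 0 < e).
Variable m : set (Rn R n) -> \bar R.
Hypothesis bm : ball_function m.
Local Open Scope ereal_scope.
Local Notation h := (wolff_den N e m).
Local Notation T := (wolff_tail N e m).
Local Notation leb := (@lebesgue_measure R).
Local Notation O := (origin R n).

(** A ball of infinite mass lies in all large balls about the origin, which makes the integrand
    infinite on a whole interval (b, b + 1]. *)
Lemma ball_finite_of_tail (a : R) x t : T O a < +oo -> m (eball x t) < +oo.
Proof.
move=> Ta; rewrite ltNge leye_eq; apply/negP => /eqP mxt.
pose b := Num.max (Num.max a 1%R) (edist O x + t)%R.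
have [ab bt] : (a <= b)%R /\ (edist O x + t <= b)%R by rewrite /b !le_max !lexx ?orbT.
have b0 : (0 < b)%R by rewrite /b !lt_max ltr01 ?orbT.
suff : T O a = +oo by move=> E; rewrite E in Ta.
apply/eqP; rewrite -leye_eq.
apply: le_trans (wolff_tail_nonincreasing N e0 bm O ab).
have mI : measurable (`]b, (b + 1)%R]%classic : set R) by exact: measurable_itv.
have hl : leb (`]b, (b + 1)%R]%classic : set R) = 1.
  rewrite lebesgue_measure_itv/= lte_fin ltrDl ltr01.
  by rewrite -EFinB; congr (_%:E); ring.
have hinf s : (b < s)%R -> h O s = +oo.
  move=> bs; have s0 : (0 < s)%R by exact: lt_trans bs.
  have E : m (eball O s) = +oo.
    apply/eqP; rewrite -leye_eq -mxt; apply: bf_le => //; apply: eball_sub.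
    exact: le_trans bt (ltW bs).
  rewrite /wolff_den E gt0_mulye ?poweRyr ?gt_eqF// ?gt0_mulye//.
    by rewrite lte_fin invr_gt0.
  by rewrite lte_fin invr_gt0 powR_gt0.
apply: (@le_trans _ _ (\int[leb]_(s in `]b, (b + 1)%R]) +oo)).
  apply: (@le_trans _ _ (+oo * leb (`]b, (b + 1)%R]%classic : set R))).
    by rewrite hl mule1.
  by rewrite integral_cst.
rewrite /wolff_tail integral_mkcond [leRHS]integral_mkcond; apply: ge0_le_integral => //.
- by move=> s _; apply: erestrict_ge0.
- by apply/(measurable_restrictT _ mI); exact: measurable_cst.
- apply/(measurable_restrictT _ (measurable_ray _)); apply: measurable_funTS.
  exact: measurable_wolff_den2.
move=> s _; rewrite /patch; case: ifPn => [|_].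
  by rewrite inE/= in_itv/= => /andP[bs _]; rewrite mem_set// hinf.
by case: ifP => // _; exact: wolff_den_ge0.
Qed.

(** Beyond a radius b >= |x| the tail at x compares with the one at the origin; on (a, b] the
    density is bounded by its largest ball and smallest radius. *)
Lemma wolff_tail_finite x (a : R) : T O 1%R < +oo -> (0 < a)%R -> T x a < +oo.
Proof.
move=> T1 a0; pose b := Num.max (Num.max a 1%R) (edist O x).
have [ab [b1 bx]] : (a <= b)%R /\ (1 <= b)%R /\ (edist O x <= b)%R.
  by rewrite /b !le_max !lexx ?orbT.
have b0 : (0 < b)%R by exact: lt_le_trans ab.
have Tb : T x b < +oo.
  apply: (@le_lt_trans _ _ ((4 `^ (N * e))%:E * T O (4 * b)%R)).
    apply: (wolff_tail_comparison N e0 bm); first exact: ltW.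
    by apply: le_trans bx _; rewrite ler_peMl ?ler1n// ltW.
  apply: (@le_lt_trans _ _ ((4 `^ (N * e))%:E * T O 1%R)).
    apply: lee_wpmul2l; first by rewrite lee_fin powR_ge0.
    by apply: wolff_tail_nonincreasing => //; lra.
  by apply: lte_mul_pinfty => //; rewrite lee_fin powR_ge0.
have mI : measurable (`]a, b]%classic : set R) by exact: measurable_itv.
have mh := measurable_wolff_den2 N e0 bm x.
have -> : T x a = \int[leb]_(s in `]a, b]) h x s + T x b.
  rewrite -ge0_integral_setU//; [|exact: measurable_ray|exact: measurable_funTS| |].
  - rewrite /wolff_tail !rayE; congr (integral _ _ _).
    by rewrite -itv_bndbnd_setU// bnd_simp.
  - by move=> s _; exact: wolff_den_ge0.
  - rewrite disj_set2E; apply/eqP/seteqP; split => // s [].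
    by rewrite /ray/= in_itv/= => /andP[_ st] /(le_lt_trans st); rewrite ltxx.
apply: lte_add_pinfty => //.
pose k := poweR (m (eball x b) * ((a `^ N)^-1)%:E) e * (a^-1)%:E.
have kfin : k < +oo.
  rewrite /k muleC; apply: lte_mul_pinfty => //; first by rewrite lee_fin invr_ge0 ltW.
  apply: poweR_lty; rewrite muleC; apply: lte_mul_pinfty => //.
    by rewrite lee_fin invr_ge0 powR_ge0.
  exact: ball_finite_of_tail T1.
have k0 : 0 <= k by rewrite mule_ge0 ?poweR_ge0// lee_fin invr_ge0 ltW.
have kf : k \is a fin_num by rewrite ge0_fin_numE.
apply: (@le_lt_trans _ _ (\int[leb]_(s in `]a, b]) k)).
  apply: ge0_le_integral => //; [by move=> *; exact: wolff_den_ge0|exact: measurable_funTS|].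
  move=> s/=; rewrite in_itv/= => /andP[as_ sb]; have s0 := lt_trans a0 as_.
  apply: lee_pmul; [exact: poweR_ge0|by rewrite lee_fin invr_ge0 ltW| |].
    apply: le_poweR; first exact: ltW.
      by rewrite mule_ge0 ?bf_ge0// lee_fin invr_ge0 powR_ge0.
    apply: lee_pmul; [exact: bf_ge0|by rewrite lee_fin invr_ge0 powR_ge0| |].
      by apply: bf_le => //; exact: eballS.
    rewrite lee_fin lef_pV2 ?posrE ?powR_gt0//.
    by apply: ge0_ler_powR; rewrite ?nnegrE ?(ltW N0) ?(ltW a0) ?(ltW s0) ?(ltW as_).
  by rewrite lee_fin lef_pV2 ?posrE// ltW.
apply: (@le_lt_trans _ _ (k * leb (`]a, b]%classic : set R))); first by rewrite integral_cst.
rewrite -(fineK kf); apply: lte_mul_pinfty => //.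
  by rewrite lee_fin fine_ge0.
rewrite lebesgue_measure_itv/=.
by case: ifP => // _; rewrite -EFinB ltry.
Qed.
End tail_finite.

(** * Exhaustion of open sets by compact sets *)

Section open_sigma_compact.
Context (R : realType) (n : nat).

Lemma open_sigma_compact (U : set 'rV[R]_n) : open U ->
  exists K : (set 'rV[R]_n)^nat, [/\ forall k, compact (K k),
    nondecreasing_seq K & U = \bigcup_k K k].
Proof.
move=> oU; pose K (k : nat) : set 'rV[R]_n := [set x | `|x| <= k%:R] `&`
  \bigcap_(y in ~` U) [set x | k.+1%:R^-1 <= `|x - y|].
exists K; split.
- move=> k; apply: bounded_closed_compact.
    exists k%:R; split; first exact: num_real.
    by move=> M kM x [/= xk _]; rewrite (le_trans xk)// ltW.
  apply: closedI.
    rewrite (_ : [set x | _] = (fun x : 'rV[R]_n => `|x|) @^-1` [set t : R | t <= k%:R])//.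
    by apply: closed_comp => [x _|]; [exact: norm_continuous|exact: closed_le].
  apply: closed_bigI => y _.
  rewrite (_ : [set x | _] = ~` ball y k.+1%:R^-1).
    by apply: open_closedC; apply: ball_open; rewrite invr_gt0.
  rewrite -ball_normE; apply/seteqP; split => x /=; rewrite distrC => h.
    by apply/negP; rewrite -leNgt.
  by rewrite leNgt; apply/negP.
- move=> k l kl; rewrite subsetEset => x [/= xk xU]; split => /=.
    by rewrite (le_trans xk)// ler_nat.
  move=> y Uy; apply: le_trans (xU y Uy).
  by rewrite lef_pV2 ?posrE// ler_nat.
apply/seteqP; split => [x Ux|x [k _ [_ xU]]]; last first.
  apply: contrapT => nUx; have := xU x nUx.
  by rewrite /= subrr normr0 leNgt invr_gt0 ltr0n.
have := oU; rewrite openE => /(_ _ Ux) /nbhs_ballP[e/= e0 xeU].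
exists (maxn (Num.trunc `|x|).+1 (Num.trunc e^-1)) => //; split => /=.
  apply: (@le_trans _ _ (Num.trunc `|x|).+1%:R); first exact/ltW/truncnS_gt.
  by rewrite ler_nat leq_maxl.
move=> y nUy /=; rewrite leNgt; apply/negP => xy; apply: nUy; apply: xeU.
rewrite -ball_normE/=; apply: lt_le_trans xy _.
rewrite invf_ple ?posrE//; apply: (@le_trans _ _ (Num.trunc e^-1).+1%:R).
  exact/ltW/truncnS_gt.
by rewrite ler_nat ltnS leq_maxr.
Qed.

(** The capacity hypothesis speaks of compact sets; continuity from below along a compact exhaustion
    extends its consequences to open sets. *)
Lemma measure_open_le (sigma : {measure set (Rn R n) -> \bar R}) (U : set 'rV[R]_n)
    (M : \bar R) : open U ->
  (forall K : set 'rV[R]_n, compact K -> K `<=` U -> (sigma (K : set (Rn R n)) <= M)%E) ->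
  (sigma (U : set (Rn R n)) <= M)%E.
Proof.
move=> /[dup] oU /open_sigma_compact[K [cK ndK UE]] HK.
have mK k : measurable (K k : set (Rn R n)).
  rewrite -(setCK (K k)); apply: measurableC; apply: open_measurable_Rn.
  by apply: closed_openC; apply: compact_closed => //; exact: norm_hausdorff.
have := @nondecreasing_cvg_mu _ _ _ sigma (K : (set (Rn R n))^nat) mK (bigcup_measurable (fun k _ => mK k)) ndK.
rewrite -UE => /cvg_lim <- //; apply: lime_le; last first.
  by apply: nearW => k; apply: HK => //; rewrite UE; exact: bigcup_sup.
apply: ereal_nondecreasing_is_cvgn => k l kl; apply: le_measure; rewrite ?inE//.
by apply/subsetPset; exact: ndK.
Qed.
End open_sigma_compact.

(** * The weak-type inequality between sigma and mu *)

Section weak_type.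
Context (R : realType) (n : nat) (alpha p : R).
Hypotheses (p1 : 1 < p) (alpha0 : 0 < alpha) (alphap : alpha * p < n%:R).
Local Open Scope ereal_scope.
Let N := (n%:R - alpha * p)%R.
Let e := ((p - 1)^-1)%R.
Let e0 : (0 < e)%R. Proof. by rewrite invr_gt0 subr_gt0. Qed.
Let N0 : (0 < N)%R. Proof. by rewrite subr_gt0. Qed.

(** The strict inequality survives at some radius a > 0, and tail comparison passes it to all of
    B(x, a) at the price of 4^(N e). This places an open set between two superlevel sets. *)
Lemma interior_superlevel (m : set (Rn R n) -> \bar R) (M : \bar R) : ball_function m ->
  [set x | (4 `^ (N * e))%:E * M < wolff_tail N e m x 0] `<=`
  ([set x | M < wolff_tail N e m x 0] : set 'rV[R]_n)°.
Proof.
move=> bm x /= xM; have D0 : (0 < 4 `^ (N * e))%R by rewrite powR_gt0.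
have [a a0 Ta] := integral_ray_gt (measurable_wolff_den2 N e0 bm x) (wolff_den_ge0 N e0 bm x) xM.
have : nbhs (x : 'rV[R]_n) (eball x a : set 'rV[R]_n).
  apply: open_nbhs_nbhs; split; first exact: eball_open.
  by rewrite /eball/= Rn_distxx.
apply: filterS => y xy /=.
have h1 : (4 `^ (N * e))%:E * M < (4 `^ (N * e))%:E * wolff_tail N e m y (4 * a)%R.
  apply: lt_le_trans Ta _; apply: (wolff_tail_comparison N e0 bm); first exact: ltW.
  by rewrite Rn_distC; apply: le_trans (ltW xy) _; rewrite ler_peMl ?ler1n// ltW.
move: h1; rewrite lte_pmul2l// => /lt_le_trans; apply.
by apply: wolff_tail_nonincreasing => //; rewrite mulr_ge0// ltW.
Qed.

(** The capacity estimate is applied at the level l = D^2 lam, so that its right-hand side lives on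
    {T >= l / D^2} = {T >= lam}. The power lam^(-(p-1)) is lam^(-p) from normalising f times lam
    from the Fubini bound. *)
Lemma wolff_weak_type : exists c K : R, [/\ (0 < c)%R, (1 < K)%R &
  forall (sigma : {measure set (Rn R n) -> \bar R}) (C : R), (0 < C)%R ->
  (forall E : set 'rV[R]_n, compact E ->
       sigma E <= C%:E * cap alpha p (E : set (Rn R n))) ->
  forall mu : {sigma_finite_measure set (Rn R n) -> \bar R},
    mu setT < +oo -> (forall x a, (0 < a)%R -> wolff_tail N e mu x a < +oo) ->
  forall lam, (0 < lam)%R ->
    sigma [set x | (K * lam)%:E <= wolff_tail N e mu x 0] <=
      (C * c * lam `^ (- (p - 1)))%:E * mu [set x | lam%:E <= wolff_tail N e mu x 0] ].
Proof.
have [L [LE [v [V [v0 V0 ballL]]]]] := lebesgueRn_ballP R n.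
set D := (4 `^ (N * e))%R.
have D1 : (1 <= D)%R.
  by rewrite /D -{1}(powRr0 4); apply: ler_powR; rewrite ?ler1n// mulr_ge0// ltW.
have D0 : (0 < D)%R by exact: lt_le_trans D1.
set kp := (((n%:R - alpha) * (1 + e) + 1) / p)%R.
pose A := (v * 2 `^ (- kp))%R.
have A0 : (0 < A)%R by rewrite mulr_gt0// powR_gt0.
pose B := (V * 2 ^+ n * 4 `^ (N * e + 1))%R.
have B0 : (0 < B)%R by rewrite !mulr_gt0 ?powR_gt0// exprn_gt0.
pose c := (((A * D ^+ 2) `^ (- p)) * (B * (2 * D ^+ 2 * D ^+ 2 / 4)))%R.
have c0 : (0 < c)%R.
  by rewrite !mulr_gt0 ?powR_gt0 ?mulr_gt0 ?exprn_gt0.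
(* D^2 comes from l, one more D from passing to the interior and 2 from the level 2 l; the last 2
   keeps the inequality strict. *)
exists c, (4 * D ^+ 3)%R; split => //.
  have : (1 <= D ^+ 3)%R by exact: exprn_ege1.
  by move=> h; lra.
move=> sigma C C0 HC mu muT Tfin lam lam0.
pose l := (D ^+ 2 * lam)%R.
have l0 : (0 < l)%R by rewrite mulr_gt0// exprn_gt0.
have bm := ball_function_measure mu.
set T := wolff_tail N e mu.
pose U := ([set x | (2 * l)%:E < T x 0%R] : set 'rV[R]_n)°.
have US : U `<=` [set x | (2 * l)%:E < T x 0%R] by exact: interior_subset.
have mT : measurable_fun setT (T ^~ 0%R) by exact: measurable_wolff_tail1.
apply: (@le_trans _ _ (sigma (U : set (Rn R n)))).
  apply: le_measure; rewrite ?inE.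
  - by rewrite -[X in measurable X]setTI; apply: measurable_lee.
  - by apply: open_measurable_Rn; exact: open_interior.
  move=> x /= xT; apply: (interior_superlevel bm) => /=.
  apply: lt_le_trans xT; rewrite -EFinM lte_fin -/D /l.
  have -> : (D * (2 * (D ^+ 2 * lam)) = 2 * (D ^+ 3 * lam))%R by ring.
  rewrite -mulrA ltr_pM2r ?mulr_gt0 ?exprn_gt0//.
  by rewrite ltr_nat.
apply: measure_open_le; first exact: open_interior.
move=> E cE EU; apply: le_trans (HC E cE) _.
rewrite -mulrA EFinM -muleA; apply: lee_wpmul2l; first by rewrite lee_fin ltW.
have := cap_superlevel_le p1 alpha0 alphap v0 V0 ballL muT Tfin l0 LE
  (fun x Ex => US _ (EU _ Ex)).
rewrite -/N -/e -/D -/kp -/A -/B -/T => /le_trans; apply.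
have -> : (l / D ^+ 2 = lam)%R by rewrite /l; field; rewrite gt_eqF.
apply: lee_wpmul2r; first exact: measure_ge0.
rewrite lee_fin le_eqVlt; apply/orP; left; apply/eqP.
have hD : (0 <= D ^+ 2)%R by rewrite exprn_ge0// ltW.
rewrite /c /l (powRM (- p) (ltW A0) (mulr_ge0 hD (ltW lam0))) (powRM (- p) hD (ltW lam0)).
rewrite (powRM (- p) (ltW A0) hD).
have -> : (- (p - 1) = - p + 1)%R by ring.
rewrite (@powRD _ lam); last by rewrite (gt_eqF lam0) implybT.
rewrite (powRr1 (ltW lam0)).
by move: (lam `^ (- p))%R (A `^ (- p))%R ((D ^+ 2) `^ (- p))%R => x y z; ring.
Qed.
End weak_type.

(** * Moments of Wolff potentials on balls *)

Section poweR_limits.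
Context {R : realType}.
Local Open Scope ereal_scope.

Lemma poweR_cancel (s : R) (x : \bar R) : (0 < s)%R -> 0 <= x -> poweR (poweR x s) s^-1 = x.
Proof. by move=> s0 x0; rewrite -poweRrM mulfV ?gt_eqF// poweRe1. Qed.

Lemma limn_poweR (u : (\bar R)^nat) (s : R) : (0 < s)%R -> nondecreasing_seq u ->
  (forall k, 0 <= u k) -> limn (fun k => poweR (u k) s) = poweR (limn u) s.
Proof.
move=> s0 ndu u0.
have cu : cvgn u by exact: ereal_nondecreasing_is_cvgn.
have ndp : nondecreasing_seq (fun k => poweR (u k) s).
  by move=> k l kl; apply: le_poweR => //; [exact: ltW|exact: ndu].
have cp := ereal_nondecreasing_is_cvgn ndp.
have le_lim (v : (\bar R)^nat) : nondecreasing_seq v -> forall k, v k <= limn v.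
  move=> ndv k; apply: lime_ge; first exact: ereal_nondecreasing_is_cvgn.
  by exists k => // l /= kl; exact: ndv.
apply/eqP; rewrite eq_le; apply/andP; split.
  apply: lime_le => //; apply: nearW => k; apply: le_poweR => //; [exact: ltW|exact: le_lim].
set S := limn (fun k => poweR (u k) s).
have S0 : 0 <= S by apply: le_trans (le_lim _ ndp 0%N); exact: poweR_ge0.
rewrite -(@poweR_cancel s^-1 S) ?invr_gt0// invrK.
apply: le_poweR; [exact: ltW|by apply: le_trans (le_lim _ ndu 0%N)|].
apply: lime_le => //; apply: nearW => k; rewrite -(poweR_cancel s0 (u0 k)).
by apply: le_poweR; [rewrite invr_ge0 ltW|exact: poweR_ge0|exact: le_lim].
Qed.

(** Bounding a + b by twice the larger term treats s < 1 and s >= 1 alike. *)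
Lemma poweRD_le (a b : \bar R) (s : R) : (0 < s)%R -> 0 <= a -> 0 <= b ->
  poweR (a + b) s <= (2 `^ s)%:E * (poweR a s + poweR b s).
Proof.
move=> s0; wlog ab : a b / a <= b => [hw a0 b0|a0 b0].
  by have /orP[ab|ba] := le_total a b; [exact: hw|rewrite addeC [X in _ * X]addeC; exact: hw].
apply: (@le_trans _ _ (poweR (2%:E * b) s)).
  apply: le_poweR; [exact: ltW|exact: adde_ge0|].
  by rewrite mule_natl mule2n; apply: leeD.
rewrite poweRZl//; apply: lee_wpmul2l; first by rewrite lee_fin powR_ge0.
by rewrite leeDr// poweR_ge0.
Qed.

Lemma archi_expr (K : R) : (1 < K)%R -> forall x : R, exists J : nat, (x < K ^+ J)%R.
Proof.
move=> K1 x; exists (Num.trunc (x / (K - 1))).+1.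
have : (x / (K - 1) < (Num.trunc (x / (K - 1))).+1%:R)%R by exact: truncnS_gt.
rewrite ltr_pdivrMr ?subr_gt0// => /lt_le_trans; apply.
elim: _.+1 => [|k ih]; first by rewrite mul0r ler01.
rewrite exprS -natr1 mulrDl mul1r.
have : (1 <= K ^+ k)%R by rewrite exprn_ege1// ltW.
move: ih; set q := (K ^+ k)%R; move: (k%:R * _)%R => y yq q1.
have : (0 <= (K - 1) * (q - 1))%R by rewrite mulr_ge0 ?subr_ge0// ltW.
by lra.
Qed.
End poweR_limits.

Section moments.
Context {R : realType}.
Local Open Scope ereal_scope.

(* Iterating the hypothesis along lam = K^j lam0, with lam0 so large that each
   step gains the factor K^-s / 2, makes the dyadic sum for the s-th moment geometric. *)
Lemma moment_of_weak_type (A K eps s : R) : (0 < A)%R -> (1 < K)%R -> (0 < eps)%R -> (0 < s)%R ->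
  exists2 c : R, (0 < c)%R & forall d (T : measurableType d) (mu : {measure set T -> \bar R})
    (w : T -> \bar R), measurable_fun setT w -> (forall x, 0 <= w x) ->
  (forall lam, (0 < lam)%R -> mu [set x | (K * lam)%:E <= w x] <=
     (A * lam `^ (- eps))%:E * mu [set x | lam%:E <= w x]) ->
  \int[mu]_x poweR (w x) s <= c%:E * mu setT.
Proof.
move=> A0 K1 eps0 s0.
have K0 : (0 < K)%R by exact: lt_trans K1.
have Ks0 : (0 < K `^ s)%R by exact: powR_gt0.
pose th := ((2 * K `^ s)^-1)%R.
have th0 : (0 < th)%R by rewrite invr_gt0 mulr_gt0.
pose l0 := ((A / th) `^ eps^-1)%R.
have l00 : (0 < l0)%R by apply: powR_gt0; rewrite divr_gt0.
have lth l : (l0 <= l)%R -> (A * l `^ (- eps) <= th)%R.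
  move=> ll; rewrite powRN ler_pdivrMr ?powR_gt0 ?(lt_le_trans l00)//.
  rewrite mulrC -ler_pdivrMr// (_ : A / th = l0 `^ eps)%R.
    by apply: ge0_ler_powR; rewrite ?nnegrE ?(ltW eps0) ?(ltW l00)// (le_trans (ltW l00)).
  by rewrite /l0 -powRrM mulVf ?gt_eqF// powRr1// (ltW (divr_gt0 A0 th0)).
exists (l0 `^ s * (1 + K `^ s * 2))%R.
  apply: mulr_gt0; first exact: powR_gt0.
  by apply: addr_gt0 => //; exact: mulr_gt0.
move=> d T mu w mw w0 Hw.
pose lj J := (K ^+ J * l0)%R.
have lj0 J : (0 < lj J)%R by rewrite mulr_gt0// exprn_gt0.
have ljl J : (l0 <= lj J)%R by rewrite ler_peMl ?(ltW l00)// exprn_ege1// ltW.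
have ljS J : lj J.+1 = (K * lj J)%R by rewrite /lj exprS mulrA.
have ljs J : (lj J `^ s = (K `^ s) ^+ J * l0 `^ s)%R.
  elim: J => [|J ih]; first by rewrite /lj !expr0 !mul1r.
  by rewrite ljS powRM ?(ltW K0) ?(ltW (lj0 J))// ih exprS mulrA.
have muT0 : 0 <= mu setT by [].
have mS l : measurable [set x | l%:E <= w x].
  by rewrite -[X in measurable X]setTI; apply: measurable_lee.
have mJ J : mu [set x | (lj J)%:E <= w x] <= (th ^+ J)%:E * mu setT.
  elim: J => [|J ih].
    by rewrite expr0 mul1e; apply: le_measure; rewrite ?inE.
  rewrite ljS; apply: le_trans (Hw _ (lj0 J)) _.
  rewrite exprS (EFinM th) -[leRHS]muleA; apply: lee_pmul => //.
    by rewrite lee_fin mulr_ge0 ?powR_ge0// ltW.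
  by rewrite lee_fin; exact: lth.
pose g J x := poweR (mine (w x) (lj J)%:E) s.
have min0 x J : 0 <= mine (w x) (lj J)%:E by rewrite le_min w0 lee_fin ltW.
have g0 J x : 0 <= g J x by exact: poweR_ge0.
have mg J : measurable_fun setT (g J).
  apply: (@measurableT_comp _ _ _ _ _ _ (fun t : \bar R => poweR t s)).
    exact: measurable_poweR.
  by apply: measurable_mine.
have ljnd : nondecreasing_seq lj.
  apply/nondecreasing_seqP => J; rewrite ljS ler_peMl ?(ltW K1)//; exact: ltW.
have ndmin x : nondecreasing_seq (fun J => mine (w x) (lj J)%:E).
  move=> J J' JJ'; rewrite le_min ge_min lexx/= ge_min lee_fin ljnd ?orbT//.
have ndg x : nondecreasing_seq (g ^~ x).
  by move=> J J' JJ'; apply: le_poweR => //; [exact: ltW|exact: ndmin].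
have limg x : limn (g ^~ x) = poweR (w x) s.
  rewrite limn_poweR//; congr poweR; apply/eqP; rewrite eq_le; apply/andP; split.
    apply: lime_le; first exact: ereal_nondecreasing_is_cvgn.
    by apply: nearW => J; rewrite ge_min lexx.
  rewrite leNgt; apply/negP => Lw; set L := limn _ in Lw.
  have Lge J : mine (w x) (lj J)%:E <= L.
    apply: lime_ge; first exact: ereal_nondecreasing_is_cvgn.
    by exists J => // l /= kl; exact: ndmin.
  have Lfin : L \is a fin_num.
    rewrite ge0_fin_numE; last exact: le_trans (min0 x 0%N) (Lge 0%N).
    by apply: lt_le_trans Lw _; exact: leey.
  have [J HJ] := archi_expr K1 (fine L / l0).
  have := Lge J; rewrite leNgt lt_min Lw/= -(fineK Lfin) lte_fin.
  by rewrite /lj -ltr_pdivrMr// HJ.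
(* Raising the truncation level from lj J to lj J.+1 adds at most (lj J.+1)^s mu{w >= lj J}, which
   is at most l0^s K^s 2^(-J) mu(T); the bracket 2 - 2 (1/2)^J is the partial sum of the powers of
   1/2. *)
have step J : \int[mu]_x g J x <= (l0 `^ s * (1 + K `^ s * (2 - 2 * (2^-1) ^+ J)))%:E * mu setT.
  elim: J => [|J ih].
    apply: (@le_trans _ _ (\int[mu]_x (l0 `^ s)%:E)).
      apply: ge0_le_integral => //.
      move=> x _; apply: (@le_trans _ _ (poweR l0%:E s)) => //.
      apply: le_poweR => //; first exact: ltW.
      by rewrite ge_min /lj expr0 mul1r lexx orbT.
    rewrite integral_cst//; apply: lee_wpmul2r => //; rewrite lee_fin.
    by rewrite expr0 mulr1 subrr mulr0 addr0 mulr1.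
  pose S := [set x | (lj J)%:E <= w x].
  apply: (@le_trans _ _ (\int[mu]_x (g J x + (lj J.+1 `^ s)%:E * (\1_S x)%:E))).
    have m1S : measurable_fun setT (fun x => (lj J.+1 `^ s)%:E * (\1_S x)%:E : \bar R).
      by apply: measurable_funeM; apply/measurable_EFinP; apply: measurable_indic; exact: mS.
    apply: ge0_le_integral => //; first exact: emeasurable_funD.
    move=> x _; rewrite /g indicE; case: (boolP (x \in S)) => [xS|].
      rewrite mule1; apply: (@le_trans _ _ (poweR (lj J.+1)%:E s)).
        by apply: le_poweR => //; [exact: ltW|rewrite ge_min lexx orbT].
      by rewrite leeDr ?poweR_ge0.
    rewrite mule0 adde0 notin_setE /S/= => /negP; rewrite -ltNge => wl.
    apply: le_poweR => //; first exact: ltW.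
    by rewrite ge_min le_min lexx (ltW wl).
  rewrite ge0_integralD//; last 2 first.
  - by move=> x _; rewrite mule_ge0// lee_fin powR_ge0.
  - by apply: measurable_funeM; apply/measurable_EFinP; apply: measurable_indic; exact: mS.
  rewrite ge0_integralZl//; last 2 first.
  - by apply/measurable_EFinP; apply: measurable_indic; exact: mS.
  - by rewrite lee_fin powR_ge0.
  rewrite integral_indic ?setIT//; last exact: mS.
  apply: (le_trans (leeD ih (lee_wpmul2l _ (mJ J)))); first by rewrite lee_fin powR_ge0.
  rewrite muleA -EFinM -ge0_muleDl; last 2 first.
  - rewrite lee_fin mulr_ge0 ?powR_ge0// addr_ge0// mulr_ge0 ?powR_ge0//.
    by rewrite subr_ge0 ger_pMr// exprn_ile1// invf_le1// ler1n.
  - by rewrite lee_fin mulr_ge0 ?powR_ge0// exprn_ge0// ltW.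
  apply: lee_wpmul2r => //; rewrite -EFinD lee_fin le_eqVlt; apply/orP; left; apply/eqP.
  have -> : (th ^+ J = (2^-1) ^+ J * ((K `^ s) ^+ J)^-1)%R.
    by rewrite /th invfM exprMn [X in (_ * X)%R]exprVn.
  have KJ0 : ((K `^ s) ^+ J != 0)%R by rewrite expf_neq0// gt_eqF.
  rewrite ljs !exprS; move: ((K `^ s) ^+ J)%R KJ0 => q q0.
  by move: (2^-1 ^+ J)%R => r; field.
rewrite (eq_integral (fun x => limn (g ^~ x))); last by move=> x _; rewrite limg.
rewrite monotone_convergence//.
apply: lime_le.
  apply: ereal_nondecreasing_is_cvgn => J J' JJ'; apply: ge0_le_integral => //.
  by move=> x _; exact: ndg.
apply: nearW => J; apply: le_trans (step J) _; apply: lee_wpmul2r => //.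
rewrite lee_fin; apply: ler_wpM2l; first exact: powR_ge0.
rewrite lerD2l; apply: ler_wpM2l; first exact: powR_ge0.
by rewrite gerBl mulr_ge0// exprn_ge0// invr_ge0.
Qed.
End moments.

Section local_moments.
Context (R : realType) (n : nat) (alpha p : R).
Hypotheses (p1 : 1 < p) (alpha0 : 0 < alpha) (alphap : alpha * p < n%:R).
Local Open Scope ereal_scope.
Let N := (n%:R - alpha * p)%R.
Let e := ((p - 1)^-1)%R.
Let e0 : (0 < e)%R. Proof. by rewrite invr_gt0 subr_gt0. Qed.
Let N0 : (0 < N)%R. Proof. by rewrite subr_gt0. Qed.
Local Notation leb := (@lebesgue_measure R).

Definition cap_bounded (C : R) (sigma : set (Rn R n) -> \bar R) :=
  forall E : set 'rV[R]_n, compact E -> sigma E <= C%:E * cap alpha p (E : set (Rn R n)).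

(** The restricted measure has finite mass and lies below sigma, so the weak-type inequality holds
    with it on both sides and [moment_of_weak_type] applies. *)
Lemma ball_restriction_moment (C s : R) : (0 < C)%R -> (0 < s)%R ->
  exists2 c : R, (0 < c)%R &
  forall sigma : {sigma_finite_measure set (Rn R n) -> \bar R}, cap_bounded C sigma ->
    wolff_tail N e sigma (origin R n) 1 < +oo ->
  forall x t, \int[sigma]_(y in eball x t)
     poweR (wolff_tail N e (mrestr sigma (measurable_eball x t)) y 0) s <=
     c%:E * sigma (eball x t).
Proof.
move=> C0 s0; have [c [K [c0 K1 Hweak]]] := wolff_weak_type p1 alpha0 alphap.
have p10 : (0 < p - 1)%R by rewrite subr_gt0.
have [c' c'0 Hmom] := moment_of_weak_type (mulr_gt0 C0 c0) K1 p10 s0.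
exists c' => //.
move=> sigma HC Hfin x t; set mB := measurable_eball x t.
have bs := ball_function_measure sigma.
pose mu : {measure set (Rn R n) -> \bar R} := measure_function_mrestr__canonical__measure_function_Measure sigma mB.
have muE A : mu A = sigma (A `&` eball x t) by [].
have muT : mu setT < +oo.
  by rewrite muE setTI; apply: (ball_finite_of_tail e0 bs) Hfin.
have musigma A : measurable A -> mu A <= sigma A.
  by move=> mA; rewrite muE; apply: le_measure; rewrite ?inE//; exact: measurableI.
have sf : sigma_finite [set: Rn R n] mu.
  by exists (fun=> setT) => //; rewrite bigcup_const//; exists 0%N.
have [nu nuE] := sigma_finite_measureP sf.
have nusigma A : measurable A -> nu A <= sigma A by rewrite nuE; exact: musigma.
have bm := ball_function_measure nu.
have nuT : nu setT < +oo by rewrite nuE.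
have Tfin y a : (0 < a)%R -> wolff_tail N e nu y a < +oo.
  move=> a0; apply: le_lt_trans (wolff_tail_finite N0 e0 bs y Hfin a0).
  apply: ge0_le_integral.
  - exact: measurable_ray.
  - by move=> u _; exact: wolff_den_ge0.
  - by apply: measurable_funTS; exact: measurable_wolff_den2.
  - by apply: measurable_funTS; exact: measurable_wolff_den2.
  move=> u au; have u0 : (0 < u)%R by exact: lt_trans au.
  apply: lee_wpmul2r; first by rewrite lee_fin invr_ge0 ltW.
  apply: le_poweR; [exact: ltW|by rewrite mule_ge0// lee_fin invr_ge0 powR_ge0|].
  apply: lee_wpmul2r; first by rewrite lee_fin invr_ge0 powR_ge0.
  by apply: nusigma; exact: measurable_eball.
have mT : measurable_fun setT (fun y => wolff_tail N e nu y 0%R) by exact: measurable_wolff_tail1.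
apply: (@le_trans _ _ (\int[nu]_y poweR (wolff_tail N e nu y 0%R) s)); last first.
  apply: (@le_trans _ _ (c'%:E * nu setT)); last by rewrite nuE muE setTI.
  apply: Hmom => //; first by move=> y; exact: wolff_tail_ge0.
  move=> l l0; apply: le_trans (Hweak sigma C C0 HC nu nuT Tfin l l0).
  by apply: nusigma; rewrite -[X in measurable X]setTI; apply: measurable_lee.
have mP : measurable_fun setT (fun y => poweR (wolff_tail N e nu y 0%R) s).
  apply: (@measurableT_comp _ _ _ _ _ _ (fun t : \bar R => poweR t s)) => //.
  exact: measurable_poweR.
apply: (@le_trans _ _ (\int[nu]_(y in eball x t) poweR (wolff_tail N e nu y 0%R) s)).
  rewrite nuE le_eqVlt; apply/orP; left; apply/eqP.
  apply: eq_measure_integral => A mA AB; rewrite -[RHS]/(mu A) muE.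
  by congr (sigma _); apply/esym/setIidl.
apply: ge0_subset_integral => //.
by move=> y _; exact: poweR_ge0.
Qed.
End local_moments.

(** * Self-improving bounds *)

Section wolff_bounds.
Context (R : realType) (n : nat) (N e : R).
Hypotheses (N0 : 0 < N) (e0 : 0 < e).
Local Open Scope ereal_scope.
Local Notation leb := (@lebesgue_measure R).
Local Notation D := (4 `^ (N * e))%R.

Lemma wolff_den_le (m1 m2 : set (Rn R n) -> \bar R) x t :
  (0 < t)%R -> 0 <= m1 (eball x t) -> m1 (eball x t) <= m2 (eball x t) ->
  wolff_den N e m1 x t <= wolff_den N e m2 x t.
Proof.
move=> t0 m10 m12; apply: lee_wpmul2r; first by rewrite lee_fin invr_ge0 ltW.
apply: le_poweR; [exact: ltW|by rewrite mule_ge0// lee_fin invr_ge0 powR_ge0|].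
by apply: lee_wpmul2r => //; rewrite lee_fin invr_ge0 powR_ge0.
Qed.

Lemma wolff_tail_le (m1 m2 : set (Rn R n) -> \bar R) x :
  ball_function m1 -> ball_function m2 ->
  (forall t, (0 < t)%R -> m1 (eball x t) <= m2 (eball x t)) ->
  wolff_tail N e m1 x 0 <= wolff_tail N e m2 x 0.
Proof.
move=> b1 b2 m12; apply: ge0_le_integral.
- exact: measurable_ray.
- by move=> u _; exact: wolff_den_ge0.
- by apply: measurable_funTS; exact: measurable_wolff_den2.
- by apply: measurable_funTS; exact: measurable_wolff_den2.
by move=> t t0; apply: wolff_den_le => //; [exact: bf_ge0|exact: m12].
Qed.

(** The factor k^e is homogeneity of the density in the measure; 4^(N e) is the price of rescaling
    t. *)
Lemma wolff_tail_le_dilated (m1 m2 : set (Rn R n) -> \bar R) x (k : R) : (0 <= k)%R ->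
  ball_function m1 -> ball_function m2 ->
  (forall t, (0 < t)%R -> m1 (eball x t) <= k%:E * m2 (eball x (4 * t)%R)) ->
  wolff_tail N e m1 x 0 <= (k `^ e * D)%:E * wolff_tail N e m2 x 0.
Proof.
move=> k0 b1 b2 m12.
have mh := measurable_wolff_den2 N e0 b2 x.
have h0 := wolff_den_ge0 N e0 b2 x.
have -> : wolff_tail N e m2 x 0%R = 4%:E * \int[leb]_(t in ray 0%R) wolff_den N e m2 x (4 * t)%R.
  by rewrite -(ge0_integral_dilation 0 (ltr0n R 4) mh h0) mulr0.
have mdil : measurable_fun setT (fun s : R => wolff_den N e m2 x (4 * s)%R).
  by apply: (measurableT_comp mh); exact: mulrl_measurable.
have mr : measurable (ray 0%R : set R) by exact: measurable_ray.
have c0 : (0 <= k `^ e * D * 4)%R by rewrite !mulr_ge0 ?powR_ge0.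
have mk : measurable_fun (ray 0%R) (fun s : R => (k `^ e * D * 4)%:E * wolff_den N e m2 x (4 * s)%R).
  by apply: measurable_funeM; exact: measurable_funTS.
rewrite muleA -EFinM -ge0_integralZl; [|exact: mr|exact: measurable_funTS|by move=> *; exact: h0|by rewrite lee_fin].
apply: ge0_le_integral; [exact: mr| | |exact: mk|].
- by move=> u _; exact: wolff_den_ge0.
- by apply: measurable_funTS; exact: measurable_wolff_den2.
move=> t t0; rewrite (wolff_den_dilation N e b2 x (ltr0n R 4) t0) !muleA -EFinM.
have -> : (k `^ e * D * 4 * 4 `^ (- (N * e) - 1) = k `^ e)%R.
  rewrite powRD; last by rewrite pnatr_eq0 implybT.
  rewrite powR_inv1// powRN.
  by have := @powR_gt0 R 4 (N * e); rewrite ltr0n => /(_ isT) h; field; rewrite gt_eqF.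
apply: lee_wpmul2r; first by rewrite lee_fin invr_ge0 ltW.
have mm0 : 0 <= m2 (eball x (4 * t)%R) by exact: bf_ge0.
rewrite -poweRZl//; last by rewrite mule_ge0// lee_fin invr_ge0 powR_ge0.
apply: le_poweR; [exact: ltW|by rewrite mule_ge0 ?bf_ge0// lee_fin invr_ge0 powR_ge0|].
by rewrite muleA; apply: lee_wpmul2r; [rewrite lee_fin invr_ge0 powR_ge0|exact: m12].
Qed.

Variable sigma : {sigma_finite_measure set (Rn R n) -> \bar R}.
Local Notation T := (wolff_tail N e sigma).
Local Notation h := (wolff_den N e sigma).
Let bs := ball_function_measure sigma.

Lemma ball_function_mrestr (B : set (Rn R n)) (mB : measurable B) :
  ball_function (mrestr sigma mB).
Proof.
have m1B : measurable_fun setT (fun y => (\1_B y)%:E : \bar R).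
  by apply/measurable_EFinP; exact: measurable_indic.
have i0 y : 0 <= (\1_B y)%:E :> \bar R by rewrite lee_fin.
have [d0 d1 d2 d3] := ball_function_density sigma m1B i0.
have E x t : \int[sigma]_(y in eball x t) (\1_B y)%:E = mrestr sigma mB (eball x t).
  by rewrite integral_indic//; [rewrite setIC|exact: measurable_eball].
split.
- by rewrite /mrestr set0I measure0.
- by move=> x t; rewrite -E.
- by move=> x y s t st; rewrite -!E; exact: d2.
- by move: d3; congr (measurable_fun _ _); apply/funext => z; rewrite E.
Qed.

(** Balls about y of radius at most t stay inside B(x, 2 t), so small scales see only the restricted
    measure; large scales are compared with those at x. *)
Lemma wolff_tail_split x y (t : R) : (0 < t)%R -> eball x t y ->
  T y 0 <= wolff_tail N e (mrestr sigma (measurable_eball x (2 * t)%R)) y 0 + D%:E * T x (4 * t)%R.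
Proof.
move=> t0 xy; set m := mrestr _ _.
have bm : ball_function m by exact: ball_function_mrestr.
have mI : measurable (`]0%R, t]%classic : set R) by exact: measurable_itv.
have mh := measurable_wolff_den2 N e0 bs y.
have mh' := measurable_wolff_den2 N e0 bm y.
have -> : T y 0 = \int[leb]_(s in `]0%R, t]) h y s + T y t.
  rewrite -ge0_integral_setU//; [|exact: measurable_ray|exact: measurable_funTS| |].
  - rewrite /wolff_tail !rayE; congr (integral _ _ _).
    by rewrite -itv_bndbnd_setU// bnd_simp ltW.
  - by move=> s _; exact: wolff_den_ge0.
  - rewrite disj_set2E; apply/eqP/seteqP; split => // s [].
    by rewrite /ray/= in_itv/= => /andP[_ st] /(le_lt_trans st); rewrite ltxx.
apply: leeD; last first.
  apply: (wolff_tail_comparison N e0 bs); first exact: ltW.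
  by apply: le_trans (ltW xy) _; rewrite ler_peMl ?ler1n// ltW.
apply: (@le_trans _ _ (\int[leb]_(s in `]0%R, t]) wolff_den N e m y s)); last first.
  apply: ge0_subset_integral => //; [exact: measurable_ray|exact: measurable_funTS| |].
  - by move=> s _; exact: wolff_den_ge0.
  - by move=> s /=; rewrite in_itv/= => /andP[].
rewrite le_eqVlt; apply/orP; left; apply/eqP; apply: eq_integral => s.
rewrite inE/= in_itv/= => /andP[s0 st]; rewrite /wolff_den /m /mrestr.
have sub : eball y s `<=` eball x (2 * t)%R.
  by apply: eball_sub; move: xy; rewrite /eball/= => xy; lra.
by rewrite (setIidl sub).
Qed.

(* Restrict the integral defining the potential to the scales where the tail
   exceeds half of its total mass. *)
Lemma wolff_tail_self_lower (m : set (Rn R n) -> \bar R) x (k b : R) :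
  ball_function m -> (0 <= k)%R -> (0 < b)%R ->
  (forall t, (0 < t)%R -> k%:E * poweR (T x t) b * h x t <= wolff_den N e m x t) ->
  (k * 2 `^ (- (b + 1)))%:E * poweR (T x 0) (b + 1) <= wolff_tail N e m x 0.
Proof.
move=> bm k0 b0 Hm.
have mh := measurable_wolff_den2 N e0 bs x.
have h0 := wolff_den_ge0 N e0 bs x.
have T0 t : 0 <= T x t by exact: wolff_tail_ge0.
have key (M : R) : (0 < M)%R ->
    (k * M `^ b)%:E * (T x 0 - M%:E) <= wolff_tail N e m x 0.
  move=> M0; pose S := low_tail (h x) 0 M%:E.
  have mS : measurable S by exact: measurable_low_tail.
  have SM : \int[leb]_(t in S) h x t <= M%:E.
    by apply: integral_low_tail_le => //; rewrite lee_fin ltW.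
  have mG : measurable (ray 0%R `\` S) by apply: measurableD => //; exact: measurable_ray.
  have TE : T x 0 = \int[leb]_(t in ray 0%R `\` S) h x t + \int[leb]_(t in S) h x t.
    have -> : T x 0 = \int[leb]_(t in (ray 0%R `\` S) `|` S) h x t.
      by rewrite setUC setDUK// => t [].
    rewrite ge0_integral_setU//; first exact: measurable_funTS.
    by rewrite disj_set2E setDKI.
  have kM0 : (0 <= k * M `^ b)%R by rewrite mulr_ge0 ?powR_ge0.
  apply: (@le_trans _ _ ((k * M `^ b)%:E * \int[leb]_(t in ray 0%R `\` S) h x t)).
    apply: lee_wpmul2l; first by rewrite lee_fin.
    by rewrite leeBlDr// TE; apply: leeD2l.
  rewrite -ge0_integralZl//; [|exact: measurable_funTS].
  apply: (@le_trans _ _ (\int[leb]_(t in ray 0%R `\` S) wolff_den N e m x t)).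
    apply: ge0_le_integral => //.
    - by move=> t _; rewrite mule_ge0// lee_fin.
    - by apply: measurable_funeM; exact: measurable_funTS.
    - by apply: measurable_funTS; exact: measurable_wolff_den2.
    move=> t [t0 nSt]; apply: le_trans (Hm t t0); apply: lee_wpmul2r; first exact: h0.
    rewrite EFinM; apply: lee_wpmul2l; first by rewrite lee_fin.
    rewrite -poweR_EFin; apply: le_poweR; [exact: ltW|by rewrite lee_fin ltW|].
    by rewrite leNgt; apply/negP => /ltW Tt; apply: nSt; split.
  apply: ge0_subset_integral; [exact: mG|exact: measurable_ray| | |exact: subDsetl].
  - by apply: measurable_funTS; exact: measurable_wolff_den2.
  - by move=> t _; exact: wolff_den_ge0.
have [kz|k1] := eqVneq k 0%R.
  by rewrite kz mul0r mul0e; exact: wolff_tail_ge0.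
have k_gt0 : (0 < k)%R by rewrite lt_neqAle eq_sym k1.
have b10 : (0 < b + 1)%R by rewrite addr_gt0.
(* With infinite total mass, the cutoff M = 1 already makes the right-hand side infinite. With
   finite L > 0, M = L/2 gives (L/2)^b (L/2), the source of 2^(-(b + 1)). *)
move: key (T0 0%R); case E : (T x 0) => [L| |] // key L0; last first.
  have := key 1%R ltr01; rewrite powR1 mulr1 addye// gt0_muley ?lte_fin// leye_eq => /eqP ->.
  exact: leey.
rewrite lee_fin le_eqVlt in L0; case/orP: L0 => [/eqP L0|L0].
  by rewrite -L0 poweR0r ?gt_eqF// mule0; exact: wolff_tail_ge0.
have := key (L / 2)%R (divr_gt0 L0 (ltr0n R 2)); apply: le_trans.
rewrite poweR_EFin -EFinB -!EFinM lee_fin le_eqVlt; apply/orP; left; apply/eqP.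
have -> : (L - L / 2 = L / 2)%R by field.
rewrite -!mulrA; congr (_ * _)%R.
have -> : ((L / 2) `^ b * (L / 2) = (L / 2) `^ (b + 1))%R.
  by rewrite powRD ?(gt_eqF b10)// powRr1// divr_ge0// ltW.
rewrite powRM ?(ltW L0)// ?invr_ge0// mulrC -(@powR_inv1 _ 2)// -(@powRrM _ 2).
by rewrite mulN1r.
Qed.
End wolff_bounds.

Section local_moment.
Context (R : realType) (n : nat) (alpha p : R).
Hypotheses (p1 : 1 < p) (alpha0 : 0 < alpha) (alphap : alpha * p < n%:R).
Local Open Scope ereal_scope.
Let N := (n%:R - alpha * p)%R.
Let e := ((p - 1)^-1)%R.
Let e0 : (0 < e)%R. Proof. by rewrite invr_gt0 subr_gt0. Qed.
Let N0 : (0 < N)%R. Proof. by rewrite subr_gt0. Qed.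

(** After [wolff_tail_split] the near part is controlled by [ball_restriction_moment] on B(x, 2 t),
    and the far part is constant on B(x, t). *)
Lemma local_moment (C s : R) : (0 < C)%R -> (0 < s)%R ->
  exists2 c : R, (0 < c)%R &
  forall sigma : {sigma_finite_measure set (Rn R n) -> \bar R}, cap_bounded alpha p C sigma ->
    wolff_tail N e sigma (origin R n) 1 < +oo ->
  forall x t, (0 < t)%R -> \int[sigma]_(y in eball x t) poweR (wolff_tail N e sigma y 0) s <=
     c%:E * (sigma (eball x (2 * t)%R) + poweR (wolff_tail N e sigma x (4 * t)%R) s * sigma (eball x t)).
Proof.
move=> C0 s0; have [c c0 Hc] := ball_restriction_moment p1 alpha0 alphap C0 s0.
set D := (4 `^ (N * e))%R.
exists (2 `^ s * (c + D `^ s))%R.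
  by rewrite mulr_gt0 ?powR_gt0// addr_gt0// powR_gt0// powR_gt0.
move=> sigma HC Hfin x t t0.
have bs := ball_function_measure sigma.
set T := wolff_tail N e sigma; set m := mrestr sigma (measurable_eball x (2 * t)%R).
have bm : ball_function m by exact: ball_function_mrestr.
have mpow (f : Rn R n -> \bar R) : measurable_fun setT f -> measurable_fun setT (fun y => poweR (f y) s).
  move=> mf; apply: (@measurableT_comp _ _ _ _ _ _ (fun t : \bar R => poweR t s)) => //.
  exact: measurable_poweR.
have mT : measurable_fun setT (fun y => poweR (T y 0%R) s).
  by apply: mpow; exact: measurable_wolff_tail1.
have mm : measurable_fun setT (fun y => poweR (wolff_tail N e m y 0%R) s).
  by apply: mpow; exact: measurable_wolff_tail1.
have mB := measurable_eball x t.
have T0 y a : 0 <= T y a by exact: wolff_tail_ge0.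
have S0 : 0 <= sigma (eball x (2 * t)%R) by [].
have P0 : 0 <= poweR (T x (4 * t)%R) s * sigma (eball x t) by rewrite mule_ge0 ?poweR_ge0.
apply: (@le_trans _ _ (\int[sigma]_(y in eball x t) ((2 `^ s)%:E *
    (poweR (wolff_tail N e m y 0%R) s + (D `^ s)%:E * poweR (T x (4 * t)%R) s)))).
  apply: ge0_le_integral => //.
  - by move=> y _; exact: poweR_ge0.
  - exact: measurable_funTS.
  - by apply: measurable_funeM; apply: emeasurable_funD => //; exact: measurable_funTS.
  move=> y xy; rewrite -poweRZl ?powR_ge0//.
  apply: le_trans (poweRD_le s0 _ _); [|exact: wolff_tail_ge0|by rewrite mule_ge0// lee_fin powR_ge0].
  by apply: le_poweR => //; [exact: ltW|exact: wolff_tail_split].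
have cst0 : 0 <= (D `^ s)%:E * poweR (T x (4 * t)%R) s.
  by rewrite mule_ge0 ?poweR_ge0// lee_fin powR_ge0.
rewrite ge0_integralZl//; last 2 first.
- by apply: emeasurable_funD => //; exact: measurable_funTS.
- by move=> y _; rewrite adde_ge0// poweR_ge0.
rewrite EFinM -muleA; apply: lee_wpmul2l; first by rewrite lee_fin powR_ge0.
rewrite ge0_integralD//; last 2 first.
- by move=> y _; exact: poweR_ge0.
- exact: measurable_funTS.
have i1 : \int[sigma]_(y in eball x t) poweR (wolff_tail N e m y 0%R) s <= c%:E * sigma (eball x (2 * t)%R).
  apply: le_trans (Hc sigma HC Hfin x (2 * t)%R).
  apply: ge0_subset_integral => //; [exact: measurable_eball|exact: measurable_funTS| |].
  - by move=> y _; exact: poweR_ge0.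
  - by apply: eballS; rewrite ler_peMl ?ler1n// ltW.
rewrite integral_cst//; apply: (le_trans (leeD2r _ i1)).
rewrite ge0_muleDr//; apply: leeD.
  by apply: lee_wpmul2r => //; rewrite lee_fin lerDl powR_ge0.
rewrite -muleA; apply: lee_wpmul2r => //.
by rewrite lee_fin lerDr ltW.
Qed.
End local_moment.

(** * Monotone iteration *)

Section monotone_iteration.
Context (R : realType) (n : nat) (N e q r : R).
Hypotheses (e0 : 0 < e) (q0 : 0 < q).
Local Open Scope ereal_scope.
Local Notation leb := (@lebesgue_measure R).
Variable sigma : {sigma_finite_measure set (Rn R n) -> \bar R}.
Local Notation dens u := (density_measure sigma u q).
Let Phi (u : Rn R n -> \bar R) x := wolff_tail N e (dens u) x 0 + r%:E.

Lemma measurable_poweR_fun (s : R) (u : Rn R n -> \bar R) :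
  measurable_fun setT u -> measurable_fun setT (fun y => poweR (u y) s).
Proof.
move=> mu; apply: (@measurableT_comp _ _ _ _ _ _ (fun t : \bar R => poweR t s)) => //.
exact: measurable_poweR.
Qed.

Lemma ball_function_density_measure u : measurable_fun setT u -> ball_function (dens u).
Proof.
move=> mu; apply: ball_function_density => [|y]; last exact: poweR_ge0.
exact: measurable_poweR_fun.
Qed.

Let Phi_measurable u : measurable_fun setT u -> measurable_fun setT (Phi u).
Proof.
move=> mu; apply: emeasurable_funD => //; apply: measurable_wolff_tail1 => //.
exact: ball_function_density_measure.
Qed.

Let dens_le u u' x t : measurable_fun setT u -> measurable_fun setT u' ->
  (forall y, 0 <= u y) -> (forall y, u y <= u' y) -> dens u (eball x t) <= dens u' (eball x t).
Proof.
move=> mu mu' u0 uu'; apply: ge0_le_integral; first exact: measurable_eball.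
- by move=> y _; exact: poweR_ge0.
- by apply: measurable_funTS; exact: measurable_poweR_fun.
- by apply: measurable_funTS; exact: measurable_poweR_fun.
- by move=> y _; apply: le_poweR => //; exact: ltW.
Qed.

Let Phi_le u u' : measurable_fun setT u -> measurable_fun setT u' ->
  (forall y, 0 <= u y) -> (forall y, u y <= u' y) -> forall x, Phi u x <= Phi u' x.
Proof.
move=> mu mu' u0 uu' x; apply: leeD2r; apply: wolff_tail_le => //.
- exact: ball_function_density_measure.
- exact: ball_function_density_measure.
- by move=> t _; exact: dens_le.
Qed.

Let cvg_poweR (a : (\bar R)^nat) (l : \bar R) (s : R) : (0 < s)%R -> nondecreasing_seq a ->
  (forall k, 0 <= a k) -> a @ \oo --> l -> (fun k => poweR (a k) s) @ \oo --> poweR l s.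
Proof.
move=> s0 nda a0 al; rewrite -(cvg_lim _ al)// -limn_poweR//.
apply: ereal_nondecreasing_is_cvgn => i j ij; apply: le_poweR => //; [exact: ltW|exact: nda].
Qed.

(** Monotone convergence acts twice, for u_k^q on each ball and then for the densities in t; in
    between, powers commute with increasing limits. *)
Let Phi_cvg (u_ : nat -> Rn R n -> \bar R) : (forall k, measurable_fun setT (u_ k)) ->
  (forall k y, 0 <= u_ k y) -> (forall y, nondecreasing_seq (u_ ^~ y)) ->
  forall x, (fun k => Phi (u_ k) x) @ \oo --> Phi (fun y => limn (u_ ^~ y)) x.
Proof.
move=> mu u0 ndu x; set u := fun y => limn (u_ ^~ y).
have cu y : u_ ^~ y @ \oo --> u y by exact: ereal_nondecreasing_is_cvgn.
have cdens t : (fun k => dens (u_ k) (eball x t)) @ \oo --> dens u (eball x t).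
  rewrite /density_measure.
  rewrite (eq_integral (fun y => limn (fun k => poweR (u_ k y) q))); last first.
    by move=> y _; rewrite limn_poweR.
  apply: cvg_monotone_convergence; first exact: measurable_eball.
  - by move=> k; apply: measurable_funTS; exact: measurable_poweR_fun.
  - by move=> k y _; exact: poweR_ge0.
  - by move=> y _ i j ij; apply: le_poweR => //; [exact: ltW|exact: ndu].
have nddens t : nondecreasing_seq (fun k => dens (u_ k) (eball x t)).
  by move=> i j ij; apply: dens_le => // y; exact: ndu.
have dens0 k t : 0 <= dens (u_ k) (eball x t) by apply: integral_ge0 => y _; exact: poweR_ge0.
have ndden t : ray 0%R t -> nondecreasing_seq (fun k => wolff_den N e (dens (u_ k)) x t).
  by move=> t0 i j ij; apply: wolff_den_le => //; exact: nddens.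
have cden t : ray 0%R t -> (fun k => wolff_den N e (dens (u_ k)) x t) @ \oo --> wolff_den N e (dens u) x t.
  move=> t0; apply: cvgeZr => //; apply: cvg_poweR => //.
  - move=> i j ij; apply: lee_wpmul2r; first by rewrite lee_fin invr_ge0 powR_ge0.
    exact: nddens.
  - by move=> k; rewrite mule_ge0// lee_fin invr_ge0 powR_ge0.
  - by apply: cvgeZr.
apply: (@cvgeD _ _ _ _ (fun k => wolff_tail N e (dens (u_ k)) x 0%R) (fun=> r%:E)).
- by rewrite fin_num_adde_defl.
- rewrite /wolff_tail.
  rewrite [X in _ --> X](_ : _ =
    \int[leb]_(t in ray 0%R) limn (fun k => wolff_den N e (dens (u_ k)) x t)); last first.
    by apply: eq_integral => t; rewrite inE => t0; apply/esym/cvg_lim => //; exact: cden.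
  apply: cvg_monotone_convergence; first exact: measurable_ray.
  + move=> k; apply: measurable_funTS; apply: measurable_wolff_den2 => //.
    exact: ball_function_density_measure.
  + by move=> k t _; apply: wolff_den_ge0 => //; exact: ball_function_density_measure.
  + by move=> t t0; exact: ndden.
- exact: cvg_cst.
Qed.

(** All functions take values in [0, +oo], so the increasing iterates have a limit at every point,
    including those where v is infinite. *)
Lemma sub_super_solution (u0 v : Rn R n -> \bar R) :
  measurable_fun setT u0 -> measurable_fun setT v ->
  (forall x, 0 <= u0 x) -> (forall x, u0 x <= v x) ->
  (forall x, u0 x <= wolff_tail N e (dens u0) x 0 + r%:E) ->
  (forall x, wolff_tail N e (dens v) x 0 + r%:E <= v x) ->
  exists u : Rn R n -> \bar R, [/\ measurable_fun setT u, forall x, u0 x <= u x,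
    forall x, u x <= v x & forall x, u x = wolff_tail N e (dens u) x 0 + r%:E].
Proof.
move=> mu0 mv u00 u0v sub super.
pose u_ k := iter k Phi u0.
have mu_ k : measurable_fun setT (u_ k) by elim: k => //= k ih; exact: Phi_measurable.
have stepu k : forall x, 0 <= u_ k x /\ u_ k x <= u_ k.+1 x.
  elim: k => [|k ih] x; first by split; [exact: u00|exact: sub].
  have nn y : 0 <= u_ k.+1 y by have [h1 h2] := ih y; exact: le_trans h2.
  split; first exact: nn.
  apply: Phi_le; [exact: mu_|exact: (mu_ k.+1)| |].
  - by move=> y; case: (ih y).
  - by move=> y; case: (ih y).
have u_ge0 k y : 0 <= u_ k y by case: (stepu k y).
have ndu y : nondecreasing_seq (u_ ^~ y).
  by apply/nondecreasing_seqP => k; case: (stepu k y).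
have u_v k : forall y, u_ k y <= v y.
  elim: k => [|k ih] y; first exact: u0v.
  by apply: le_trans (super y); apply: Phi_le.
have cu y : cvgn (u_ ^~ y) by exact: ereal_nondecreasing_is_cvgn.
exists (fun y => limn (u_ ^~ y)); split.
- by apply: (emeasurable_fun_cvg u_) => // x _; exact: cu.
- move=> x; apply: lime_ge => //; apply: nearW => k; exact: (ndu x 0%N k (leq0n k)).
- by move=> x; apply: lime_le => //; apply: nearW => k; exact: u_v.
move=> x; have /cvg_lim h1 := Phi_cvg mu_ u_ge0 ndu (x := x).
rewrite -[RHS]h1//; apply/esym/cvg_lim => //.
by have := cu x; rewrite -(cvg_shiftS (u_ ^~ x)).
Qed.
End monotone_iteration.

(** * Sub- and supersolutions *)

Section barriers.
Context (R : realType) (n : nat) (p q alpha r C : R).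
Hypotheses (r0 : 0 < r) (p1 : 1 < p) (q0 : 0 < q) (qp : q < p - 1)
  (alpha0 : 0 < alpha) (alphap : alpha * p < n%:R) (C0 : 0 < C).
Local Open Scope ereal_scope.
Let N := (n%:R - alpha * p)%R.
Let e := ((p - 1)^-1)%R.
Let gam := ((p - 1) / (p - 1 - q))%R.
Let s := (gam * q)%R.
Local Notation D := (4 `^ (N * e))%R.
Implicit Types (sigma : {sigma_finite_measure set (Rn R n) -> \bar R}).

Let p10 : (0 < p - 1)%R. Proof. exact: lt_trans qp. Qed.
Let pq0 : (0 < p - 1 - q)%R. Proof. by rewrite subr_gt0. Qed.
Let e0 : (0 < e)%R. Proof. by rewrite invr_gt0. Qed.
Let N0 : (0 < N)%R. Proof. by rewrite subr_gt0. Qed.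
Let gam0 : (0 < gam)%R. Proof. exact: divr_gt0. Qed.
Let s0 : (0 < s)%R. Proof. exact: mulr_gt0. Qed.
(** The equation defining gam: a density T^s with s = gam q produces T^(s e) times the Wolff
    density, and integration raises the power by one. *)
Let seg : (s * e + 1 = gam)%R.
Proof. by rewrite /s /gam /e; field; rewrite !gt_eqF. Qed.
Let qe1 : (0 < 1 - q * e)%R.
Proof. by rewrite subr_gt0 ltr_pdivrMr// mul1r. Qed.

(** c = x^(1/(1 - q e)) solves c = c^(q e) x. *)
Let root_le (a x : R) : (0 < x)%R -> (a <= x)%R ->
  ((x `^ (1 - q * e)^-1) `^ (q * e) * a <= x `^ (1 - q * e)^-1)%R.
Proof.
move=> x0 ax; set c := (x `^ _)%R; have c0 : (0 < c)%R by exact: powR_gt0.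
rewrite [leRHS](_ : c = c `^ (q * e) * x)%R; first by apply: ler_wpM2l => //; exact: powR_ge0.
have -> : (x = c `^ (1 - q * e))%R.
  by rewrite /c -powRrM mulVf ?gt_eqF// powRr1// ltW.
rewrite -powRD; last by rewrite (gt_eqF c0) implybT.
by rewrite addrC subrK powRr1// ltW.
Qed.

Lemma wolff_power_subsolution : exists2 c0 : R, (0 < c0)%R &
  forall sigma (u : Rn R n -> \bar R), measurable_fun setT u ->
  (forall y, c0%:E * poweR (wolff_tail N e sigma y 0) gam <= u y) ->
  forall x, c0%:E * poweR (wolff_tail N e sigma x 0) gam <=
    wolff_tail N e (density_measure sigma u q) x 0.
Proof.
have D0 : (0 < D)%R by exact: powR_gt0.
pose k1 := ((D^-1 `^ s) `^ e * 2 `^ (- gam))%R.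
have k10 : (0 < k1)%R by rewrite mulr_gt0 ?powR_gt0 ?invr_gt0.
(* The fixed point of c -> c^(q e) k1. *)
pose c0 := (k1 `^ (1 - q * e)^-1)%R.
have c00 : (0 < c0)%R by exact: powR_gt0.
have c0k : (c0 <= (c0 `^ q * D^-1 `^ s) `^ e * 2 `^ (- gam))%R.
  rewrite powRM ?powR_ge0// -powRrM -mulrA -/k1.
  have -> : (k1 = c0 `^ (1 - q * e))%R.
    by rewrite /c0 -powRrM mulVf ?gt_eqF// powRr1// ltW.
  rewrite -powRD ?(gt_eqF c00) ?implybT//.
  by rewrite addrC subrK powRr1// ltW.
exists c0 => // sigma u mu Hu x.
have bs := ball_function_measure sigma.
have bd : ball_function (density_measure sigma u q) by exact: ball_function_density_measure.
set T := wolff_tail N e sigma.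
have T0 y a : 0 <= T y a by exact: wolff_tail_ge0.
have kap0 : (0 <= c0 `^ q * D^-1 `^ s)%R by rewrite mulr_ge0 ?powR_ge0.
have := @wolff_tail_self_lower R n N e e0 sigma (density_measure sigma u q) x
  ((c0 `^ q * D^-1 `^ s) `^ e) (s * e) bd (powR_ge0 _ _) (mulr_gt0 s0 e0).
rewrite seg -/T => key.
apply: (@le_trans _ _ (((c0 `^ q * D^-1 `^ s) `^ e * 2 `^ (- gam))%:E * poweR (T x 0%R) gam)).
  by apply: lee_wpmul2r; [exact: poweR_ge0|rewrite lee_fin].
apply: key => t t0.
have St : 0 <= sigma (eball x t) by [].
have cN : 0 <= ((t `^ N)^-1)%:E :> \bar R by rewrite lee_fin invr_ge0 powR_ge0.
have HB : (c0 `^ q * D^-1 `^ s)%:E * poweR (T x t) s * sigma (eball x t) <=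
    density_measure sigma u q (eball x t).
  rewrite /density_measure -integral_cst; last exact: measurable_eball.
  have cc0 : 0 <= (c0 `^ q * D^-1 `^ s)%:E * poweR (T x t) s.
    by rewrite mule_ge0 ?poweR_ge0.
  apply: ge0_le_integral; [exact: measurable_eball| | | |].
  - by move=> y _.
  - exact: measurable_cst.
  - by apply: measurable_funTS; exact: measurable_poweR_fun.
  move=> y xy; apply: (@le_trans _ _ (poweR (c0%:E * poweR (T y 0%R) gam) q)); last first.
    by apply: le_poweR => //; [exact: ltW|rewrite mule_ge0 ?poweR_ge0// lee_fin ltW].
  rewrite poweRZl ?(ltW c00) ?poweR_ge0// -poweRrM -/s EFinM -muleA.
  apply: lee_wpmul2l; first by rewrite lee_fin powR_ge0.
  rewrite -poweRZl ?invr_ge0 ?(ltW D0)//.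
  apply: le_poweR; [exact: ltW|by rewrite mule_ge0// lee_fin invr_ge0 ltW|].
  rewrite lee_pdivrMl//; apply: (@le_trans _ _ (D%:E * T y (4 * t)%R)).
    apply: (wolff_tail_comparison N e0 bs); first exact: ltW.
    by rewrite Rn_distC; apply: le_trans (ltW xy) _; rewrite ler_peMl ?ler1n// ltW.
  apply: lee_wpmul2l; first by rewrite lee_fin ltW.
  by apply: wolff_tail_nonincreasing => //; rewrite mulr_ge0// ltW.
rewrite /wolff_den muleA; apply: lee_wpmul2r; first by rewrite lee_fin invr_ge0 ltW.
rewrite poweRrM -poweR_EFin -!poweRM ?poweR_ge0 ?mule_ge0 ?poweR_ge0//.
apply: le_poweR; [exact: ltW|by rewrite !mule_ge0 ?poweR_ge0|].
by rewrite muleA; apply: lee_wpmul2r.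
Qed.

(** [local_moment] with exponent s = gam q bounds the mass of v^q dsigma on B(x, t) by a multiple of
    sigma(B(x, 4 t)). The parameter b lets c1 exceed the constant of the subsolution, which orders
    the two barriers. *)
Lemma wolff_power_supersolution (b : R) : exists c1 : R, [/\ (b <= c1)%R, (1 <= c1)%R &
  forall sigma, cap_bounded alpha p C sigma -> wolff_tail N e sigma (origin R n) 1 < +oo ->
  let v x := c1%:E * (r%:E + poweR (wolff_tail N e sigma x 0) gam) in
  forall x, wolff_tail N e (density_measure sigma v q) x 0 + r%:E <= v x].
Proof.
have [c c0 Hc] := local_moment p1 alpha0 alphap C0 s0.
have D0 : (0 < D)%R by exact: powR_gt0.
pose A := (2 `^ q * (r `^ q + 1))%R.
have rq0 : (0 <= r `^ q)%R by exact: powR_ge0.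
have A0 : (0 < A)%R by rewrite mulr_gt0 ?powR_gt0// ltr_wpDl.
pose A1 := (A `^ e * (1 + c) `^ e * 2 `^ e * D)%R.
have A10 : (0 < A1)%R by rewrite !mulr_gt0 ?powR_gt0// addr_gt0.
(* Absorbs tau <= 1 + tau^gam into r + tau^gam; the 1 costs a factor 1/r. *)
pose A2 := (A1 * (r^-1 + 2))%R.
have A20 : (0 < A2)%R by rewrite mulr_gt0// addr_gt0// invr_gt0.
pose b' := (`|b| `^ (1 - q * e))%R.
have b'0 : (0 <= b')%R by exact: powR_ge0.
(* A2 + 1 leaves room for the added r, the 1 also ensures c1 >= 1, and b' ensures c1 >= b after
   taking the root. *)
pose X := (A2 + 1 + b')%R.
have X1 : (1 <= X)%R by rewrite /X; lra.
have X0 : (0 < X)%R by exact: lt_le_trans X1.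
pose c1 := (X `^ (1 - q * e)^-1)%R.
have c10 : (0 < c1)%R by exact: powR_gt0.
have i0 : (0 <= (1 - q * e)^-1)%R by rewrite invr_ge0 ltW.
have o1 (z : R) : (1 `^ z = 1 :> R)%R by rewrite powR1.
have c11 : (1 <= c1)%R.
  by rewrite -(o1 ((1 - q * e)^-1)%R); apply: ge0_ler_powR; rewrite ?nnegrE// ltW.
have c1b : (b <= c1)%R.
  apply: le_trans (ler_norm b) _.
  have -> : (`|b| = b' `^ (1 - q * e)^-1)%R.
    by rewrite /b' -powRrM mulfV ?gt_eqF// powRr1.
  by apply: ge0_ler_powR; rewrite ?nnegrE ?(ltW X0)// /X; lra.
have c1A : (c1 `^ (q * e) * A2 + 1 <= c1)%R.
  have AX : (A2 + 1 <= X)%R by rewrite lerDl.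
  have := root_le X0 AX; rewrite -/c1; apply: le_trans.
  rewrite mulrDr mulr1 lerD2l.
  rewrite -{1}(o1 (q * e)%R); apply: ge0_ler_powR; rewrite ?nnegrE ?(ltW c10)//.
  by rewrite mulr_ge0// ltW.
exists c1; split => // sigma HC Hfin v x.
have bs := ball_function_measure sigma.
rewrite /v; set T := wolff_tail N e sigma.
have T0 y a : 0 <= T y a by exact: wolff_tail_ge0.
case E : (T x 0%R) (T0 x 0%R) => [tau| |] // tau0; last first.
  rewrite poweRyr ?gt_eqF// addey// gt0_muley ?lte_fin//; exact: leey.
rewrite lee_fin in tau0.
have mT : measurable_fun setT (T ^~ 0%R) by exact: measurable_wolff_tail1.
have mv : measurable_fun setT v.
  by apply: measurable_funeM; apply: emeasurable_funD => //; exact: measurable_poweR_fun.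
have mTs : measurable_fun setT (fun y => poweR (T y 0%R) s) by exact: measurable_poweR_fun.
have bd : ball_function (density_measure sigma v q) by exact: ball_function_density_measure.
(* tau = T_x(0) dominates every T_x(4 t), so one k serves all radii. *)
pose k := (c1 `^ q * A * (1 + c) * (1 + tau `^ s))%R.
have ts0 : (0 <= tau `^ s)%R by exact: powR_ge0.
have k0 : (0 <= k)%R.
  by rewrite !mulr_ge0 ?powR_ge0 ?(ltW A0)// addr_ge0// ltW.
have HB t : (0 < t)%R -> density_measure sigma v q (eball x t) <= k%:E * sigma (eball x (4 * t)%R).
  move=> t0; have mB := measurable_eball x t.
  have S4 : sigma (eball x t) <= sigma (eball x (4 * t)%R).
    by apply: bf_le => //; apply: eballS; rewrite ler_peMl ?ler1n// ltW.
  have S24 : sigma (eball x (2 * t)%R) <= sigma (eball x (4 * t)%R).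
    by apply: bf_le => //; apply: eballS; rewrite ler_pM2r// ler_nat.
  apply: (@le_trans _ _ (\int[sigma]_(y in eball x t) ((c1 `^ q * A)%:E * (1 + poweR (T y 0%R) s)))).
    apply: ge0_le_integral => //.
    - by move=> y _; exact: poweR_ge0.
    - by apply: measurable_funTS; exact: measurable_poweR_fun.
    - by apply: measurable_funeM; apply: emeasurable_funD => //; exact: measurable_funTS.
    move=> y _; rewrite poweRZl ?(ltW c10)//; last by rewrite adde_ge0 ?poweR_ge0// lee_fin ltW.
    rewrite EFinM -muleA; apply: lee_wpmul2l; first by rewrite lee_fin powR_ge0.
    apply: le_trans (poweRD_le q0 _ _) _; [by rewrite lee_fin ltW|exact: poweR_ge0|].
    rewrite /A EFinM -muleA; apply: lee_wpmul2l; first by rewrite lee_fin powR_ge0.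
    rewrite poweR_EFin -poweRrM -/s ge0_muleDr ?poweR_ge0// mule1; apply: leeD.
      by rewrite lee_fin lerDl.
    rewrite -[leLHS]mul1e; apply: lee_wpmul2r; first exact: poweR_ge0.
    by rewrite lee_fin lerDr.
  rewrite ge0_integralZl//; last 3 first.
  - by apply: emeasurable_funD => //; exact: measurable_funTS.
  - by move=> y _; rewrite adde_ge0// poweR_ge0.
  - by rewrite lee_fin mulr_ge0 ?powR_ge0// ltW.
  rewrite ge0_integralD//; last 2 first.
  - by move=> y _; exact: poweR_ge0.
  - exact: measurable_funTS.
  rewrite /k -(mulrA (c1 `^ q * A)%R) (EFinM (c1 `^ q * A)%R) -[leRHS]muleA; apply: lee_wpmul2l.
    by rewrite lee_fin mulr_ge0 ?powR_ge0// ltW.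
  rewrite integral_cst// mul1e.
  have step : \int[sigma]_(y in eball x t) poweR (T y 0%R) s <=
      (c + c * tau `^ s)%:E * sigma (eball x (4 * t)%R).
    apply: le_trans (Hc sigma HC Hfin x t t0) _.
    rewrite EFinD ge0_muleDl ?lee_fin ?mulr_ge0 ?(ltW c0)//.
    rewrite EFinM -muleA -ge0_muleDr; last 2 first.
    - exact: measure_ge0.
    - by rewrite mule_ge0.
    apply: lee_wpmul2l; first by rewrite lee_fin ltW.
    apply: leeD => //; apply: lee_pmul => //; first exact: poweR_ge0.
    rewrite -poweR_EFin -E; apply: le_poweR; [exact: ltW|exact: wolff_tail_ge0|].
    by apply: wolff_tail_nonincreasing => //; rewrite mulr_ge0// ltW.
  apply: (le_trans (leeD S4 step)).
  rewrite -[X in X + _]mul1e -ge0_muleDl ?lee_fin ?addr_ge0 ?mulr_ge0 ?(ltW c0)//.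
  apply: lee_wpmul2r => //; rewrite -EFinD lee_fin mulrDl mul1r mulrDr mulr1.
  by lra.
have hh : wolff_tail N e (density_measure sigma v q) x 0 <= (k `^ e * D)%:E * T x 0%R.
  exact: wolff_tail_le_dilated.
apply: (le_trans (leeD2r r%:E hh)).
rewrite E poweR_EFin -EFinM -EFinD -EFinD -EFinM lee_fin.
have kE : (k `^ e <= c1 `^ (q * e) * (A `^ e * (1 + c) `^ e * 2 `^ e) * (1 + tau `^ (s * e)))%R.
  rewrite /k powRM; last 2 first.
  - by rewrite !mulr_ge0 ?powR_ge0 ?(ltW A0)// addr_ge0// ltW.
  - by rewrite addr_ge0.
  rewrite powRM; last 2 first.
  - by rewrite mulr_ge0 ?powR_ge0 ?(ltW A0).
  - by rewrite addr_ge0// ltW.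
  rewrite powRM ?powR_ge0 ?(ltW A0)// -powRrM.
  have h : ((1 + tau `^ s) `^ e <= 2 `^ e * (1 + tau `^ (s * e)))%R.
    have := poweRD_le e0 (lee01 : 0 <= 1%:E :> \bar R) (ts0 : 0 <= (tau `^ s)%:E).
    by rewrite -EFinD !poweR_EFin -EFinD -EFinM lee_fin powR1 -powRrM.
  move: h; set z := (1 + tau `^ (s * e))%R => h.
  rewrite -!mulrA; do 3 (apply: ler_wpM2l; first exact: powR_ge0).
  exact: h.
have tauE : (tau `^ (s * e) * tau = tau `^ gam)%R.
  rewrite -{2}(powRr1 tau0) -powRD; first by rewrite seg.
  by rewrite seg (gt_eqF gam0).
have tau1 : (tau <= 1 + tau `^ gam)%R.
  have [t1|t1] := leP tau 1%R; first by rewrite (le_trans t1)// lerDl powR_ge0.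
  have : (tau `^ 1 <= tau `^ gam)%R.
    by apply: ler_powR; [exact: ltW|rewrite -seg lerDr mulr_ge0// ltW].
  by rewrite powRr1// => h; apply: le_trans h _; rewrite lerDr.
have tg0 : (0 <= tau `^ gam)%R by exact: powR_ge0.
have main : (k `^ e * D * tau <= c1 `^ (q * e) * A2 * (r + tau `^ gam))%R.
  apply: (@le_trans _ _ (c1 `^ (q * e) * (A `^ e * (1 + c) `^ e * 2 `^ e) * (1 + tau `^ (s * e)) * D * tau)%R).
    by apply: ler_wpM2r => //; apply: ler_wpM2r => //; exact: ltW.
  have -> : (c1 `^ (q * e) * (A `^ e * (1 + c) `^ e * 2 `^ e) * (1 + tau `^ (s * e)) * D * tau
     = c1 `^ (q * e) * (A1 * (tau + tau `^ gam)))%R.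
    by rewrite -tauE /A1; ring.
  rewrite -mulrA; apply: ler_wpM2l; first exact: powR_ge0.
  rewrite /A2 -mulrA; apply: ler_wpM2l; first exact: ltW.
  have -> : ((r^-1 + 2) * (r + tau `^ gam) = 1 + 2 * r + (r^-1 + 2) * tau `^ gam)%R.
    by field; rewrite gt_eqF.
  have rt0 : (0 <= r^-1 * tau `^ gam)%R by rewrite mulr_ge0// invr_ge0 ltW.
  rewrite [X in (_ <= _ + X)%R]mulrDl.
  move: (r^-1 * _)%R rt0 tau1 => z rt0; move: (tau `^ gam)%R => w tau1'.
  by have := r0; lra.
apply: (@le_trans _ _ ((c1 `^ (q * e) * A2 + 1) * (r + tau `^ gam))%R); last first.
  by apply: ler_wpM2r => //; rewrite addr_ge0// ltW.
by rewrite [leRHS]mulrDl mul1r; apply: lerD => //; rewrite lerDl.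
Qed.

(** u^s' is dominated by a constant plus a multiple of T^(gam s'), which [local_moment] integrates
    over a ball containing K. *)
Lemma wolff_power_Lloc sigma (c1 s' : R) (u : Rn R n -> \bar R) : (0 < c1)%R -> (0 < s')%R ->
  cap_bounded alpha p C sigma -> wolff_tail N e sigma (origin R n) 1 < +oo ->
  measurable_fun setT u -> (forall x, 0 <= u x) ->
  (forall x, u x <= c1%:E * (r%:E + poweR (wolff_tail N e sigma x 0) gam)) ->
  Lloc sigma s' u.
Proof.
move=> c10 s'0 HC Hfin mu u0 Hu K cK.
have [c c0 Hc] := local_moment p1 alpha0 alphap C0 (mulr_gt0 gam0 s'0).
have bs := ball_function_measure sigma.
set T := wolff_tail N e sigma in Hu *.
have [M [_ HM]] := compact_bounded cK.
(* The factor n passes from the sup norm to the Euclidean distance; the final 1 gives rho >= 1, so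
   that the tail at 4 rho is below the one at 1. *)
pose rho := (n%:R * (`|M| + 1) + 1)%R.
have rho1 : (1 <= rho)%R by rewrite lerDr mulr_ge0// addr_ge0.
have rho0 : (0 < rho)%R by exact: lt_le_trans rho1.
have KB : K `<=` eball (origin R n) rho.
  move=> x Kx; rewrite /eball/=; apply: (@le_lt_trans _ _ (n%:R * (`|M| + 1))%R); last by rewrite ltrDl.
  apply: Rn_dist_le_coord; first by rewrite addr_ge0.
  move=> i; rewrite /origin mxE subr0.
  have xM : (`|x : 'rV[R]_n| <= `|M| + 1)%R by apply: HM => //; rewrite ltr_pwDr// ler_norm.
  apply: le_trans xM; rewrite [leRHS]/Num.norm/= mx_normrE.
  by apply: (le_bigmax _ (fun ij : 'I_1 * 'I_n => `|(x : 'rV[R]_n) ij.1 ij.2|%R) (ord0, i)).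
have mK : measurable (K : set (Rn R n)).
  rewrite -(setCK K); apply: measurableC; apply: open_measurable_Rn.
  by apply: closed_openC; apply: compact_closed => //; exact: norm_hausdorff.
have mB := measurable_eball (origin R n) rho.
have mT : measurable_fun setT (T ^~ 0%R) by exact: measurable_wolff_tail1.
have T0 y a : 0 <= T y a by exact: wolff_tail_ge0.
have Bfin t : sigma (eball (origin R n) t) < +oo by apply: (ball_finite_of_tail e0 bs) Hfin.
have mTs : measurable_fun setT (fun y => poweR (T y 0%R) (gam * s')) by exact: measurable_poweR_fun.
pose k := (c1 `^ s' * 2 `^ s')%R.
have k0 : (0 <= k)%R by rewrite mulr_ge0 ?powR_ge0.
apply: (@le_lt_trans _ _ (\int[sigma]_(y in eball (origin R n) rho)
    (k%:E * ((r `^ s')%:E + poweR (T y 0%R) (gam * s'))))).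
  apply: (@le_trans _ _ (\int[sigma]_(y in (K : set (Rn R n)))
    (k%:E * ((r `^ s')%:E + poweR (T y 0%R) (gam * s'))))); last first.
    apply: ge0_subset_integral => //.
    - by apply: measurable_funeM; apply: emeasurable_funD => //; exact: measurable_funTS.
    - by move=> y _; rewrite mule_ge0// adde_ge0 ?poweR_ge0// lee_fin powR_ge0.
  apply: ge0_le_integral => //.
  - by move=> y _; exact: poweR_ge0.
  - apply: measurable_funTS; apply: measurable_poweR_fun; exact: measurableT_comp.
  - by apply: measurable_funeM; apply: emeasurable_funD => //; exact: measurable_funTS.
  move=> y _; rewrite gee0_abs//.
  apply: (@le_trans _ _ (poweR (c1%:E * (r%:E + poweR (T y 0%R) gam)) s')).
    by apply: le_poweR => //; exact: ltW.
  rewrite poweRZl ?(ltW c10)//; last by rewrite adde_ge0 ?poweR_ge0// lee_fin ltW.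
  rewrite /k EFinM -muleA; apply: lee_wpmul2l; first by rewrite lee_fin powR_ge0.
  apply: le_trans (poweRD_le s'0 _ _) _; [by rewrite lee_fin ltW|exact: poweR_ge0|].
  by rewrite poweR_EFin -poweRrM.
rewrite ge0_integralZl//; last 2 first.
- by apply: emeasurable_funD => //; exact: measurable_funTS.
- by move=> y _; rewrite adde_ge0 ?poweR_ge0// lee_fin powR_ge0.
apply: lte_mul_pinfty => //.
rewrite ge0_integralD//; last 3 first.
- by move=> y _; rewrite lee_fin powR_ge0.
- by move=> y _; exact: poweR_ge0.
- exact: measurable_funTS.
apply: lte_add_pinfty.
  rewrite integral_cst//; apply: lte_mul_pinfty; rewrite ?lee_fin ?powR_ge0//.
  exact: Bfin.
apply: le_lt_trans (Hc sigma HC Hfin (origin R n) rho rho0) _.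
apply: lte_mul_pinfty => //; first by rewrite lee_fin ltW.
have T4 : T (origin R n) (4 * rho)%R < +oo.
  by apply: le_lt_trans Hfin; apply: wolff_tail_nonincreasing => //; lra.
have P4 := poweR_lty (gam * s') T4.
apply: lte_add_pinfty => //.
have P4f : poweR (T (origin R n) (4 * rho)%R) (gam * s') \is a fin_num.
  by rewrite ge0_fin_numE// poweR_ge0.
by rewrite -/T -(fineK P4f); apply: lte_mul_pinfty => //; rewrite lee_fin fine_ge0// poweR_ge0.
Qed.
End barriers.

(** * Finiteness of sigma on compact sets and balls *)

Section local_finiteness.
Context (R : realType) (n : nat).
Local Open Scope ereal_scope.

Lemma locally_finite_compact (sigma : {measure set (Rn R n) -> \bar R}) (K : set 'rV[R]_n) :
  locally_finite sigma -> compact K -> sigma (K : set (Rn R n)) < +oo.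
Proof.
move=> lf cK; have [f Hf] := choice lf.
have mf y : measurable (f y : set (Rn R n)).
  by apply: open_measurable_Rn; case: (Hf y).
have := cK; rewrite compact_cover => /(_ 'rV[R]_n setT f).
case=> [y _|y Ky|F _]; first by case: (Hf y).
  by exists y => //; case: (Hf y).
rewrite /cover bigcup_seq; move: (finmap.enum_fset F) => l KF.
have mF : measurable ((\big[setU/set0]_(t <- l) f t) : set (Rn R n)).
  by apply: bigsetU_measurable => y _; exact: mf.
have mK : measurable (K : set (Rn R n)).
  rewrite -(setCK K); apply: measurableC; apply: open_measurable_Rn.
  by apply: closed_openC; apply: compact_closed => //; exact: norm_hausdorff.
apply: (@le_lt_trans _ _ (sigma ((\big[setU/set0]_(t <- l) f t) : set (Rn R n)))).
  by apply: le_measure; rewrite ?inE.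
elim: l {KF mF} => [|y l ih]; first by rewrite big_nil measure0.
have ml : measurable ((\big[setU/set0]_(t <- l) f t) : set (Rn R n)).
  by apply: bigsetU_measurable => z _; exact: mf.
rewrite big_cons; apply: (@le_lt_trans _ _
  (sigma (f y : set (Rn R n)) + sigma ((\big[setU/set0]_(t <- l) f t) : set (Rn R n)))).
  by apply: measureU2 => //; exact: mf.
by apply: lte_add_pinfty => //; case: (Hf y).
Qed.

(** Supplies the sigma-finiteness of sigma that Tonelli's theorem asks for. *)
Lemma locally_finite_ball (sigma : {measure set (Rn R n) -> \bar R}) t :
  locally_finite sigma -> sigma (eball (origin R n) t) < +oo.
Proof.
move=> lf; pose K : set 'rV[R]_n := [set x | (`|x| <= `|t|)%R].
have cK : compact K.
  apply: bounded_closed_compact.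
    by exists `|t|%R; split; [exact: num_real|move=> M tM x /= /le_trans -> //; exact: ltW].
  rewrite (_ : K = (fun x : 'rV[R]_n => `|x|%R) @^-1` [set u : R | (u <= `|t|)%R])//.
  by apply: closed_comp => [x _|]; [exact: norm_continuous|exact: closed_le].
apply: le_lt_trans (locally_finite_compact lf cK); apply: le_measure; rewrite ?inE.
- exact: measurable_eball.
- rewrite -(setCK K); apply: measurableC; apply: open_measurable_Rn.
  by apply: closed_openC; apply: compact_closed => //; exact: norm_hausdorff.
move=> x; rewrite /eball/= => xt; rewrite /K/= [leLHS]/Num.norm/= mx_normrE.
apply/bigmax_leP; split => // -[i j] _ /=; rewrite (ord1 i).
have := coord_le_Rn_dist (origin R n) x j; rewrite /origin mxE subr0 => /le_trans; apply.
by apply: le_trans (ltW xt) _; exact: ler_norm.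
Qed.
End local_finiteness.

Unset Implicit Arguments.

Theorem theorem3p1 (R : realType) (n : nat) (p q alpha r C : R) :
  0 < r -> 1 < p -> p < n%:R -> 0 < q -> q < p - 1 ->
  0 < alpha -> alpha < n%:R / p -> 0 < C ->
  exists c : R, 0 < c /\
  forall sigma : {measure set (Rn R n) -> \bar R},
    locally_finite sigma ->
    (forall E : set 'rV[R]_n, compact E ->
       (sigma E <= C%:E * cap alpha p (E : set (Rn R n)))%E) ->
    (\int[@lebesgue_measure R]_(t in [set t : R | (1 <= t)%R])
       (poweR (sigma (eball (origin R n) t) * ((powR t (n%:R - alpha * p))^-1)%R%:E)
              (p - 1)^-1%R * (t^-1)%R%:E) < +oo)%E ->
    exists u : Rn R n -> \bar R,
      [/\ measurable_fun [set: Rn R n] u /\ Lloc sigma q u,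
          (forall x, (0 < u x)%E),
          (forall x, u x = (Wolff alpha p (density_measure sigma u q) x + r%:E)%E),
          (forall x,
             ((c^-1)%R%:E * (r%:E + poweR (Wolff alpha p sigma x) ((p - 1) / (p - 1 - q))%R)
                <= u x)%E /\
             (u x <= c%:E * (r%:E + poweR (Wolff alpha p sigma x) ((p - 1) / (p - 1 - q))%R))%E)
        & (forall s : R, 0 < s -> Lloc sigma s u)].
Proof.
move=> r0 p1 pn q0 qp alpha0; rewrite ltr_pdivlMr; last exact: lt_trans p1.
move=> alphap C0.
set N := n%:R - alpha * p; set e := (p - 1)^-1; set gam := (p - 1) / (p - 1 - q).
have p10 : 0 < p - 1 by exact: lt_trans qp.
have N0 : 0 < N by rewrite subr_gt0.
have e0 : 0 < e by rewrite invr_gt0.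
have [c0 c00 Hsub] := @wolff_power_subsolution R n p q alpha q0 qp.
have [c1 [c01 c11 Hsuper]] := wolff_power_supersolution r0 p1 q0 qp alpha0 alphap C0 c0.
have c10 : 0 < c1 by exact: lt_le_trans c11.
(* c1 serves the upper bound; 2 and 2 / c0 give 1/c <= 1/2 and 1/c <= c0/2 for the two terms of the
   lower bound. *)
pose c := c1 + 2 + 2 / c0.
have c20 : 0 < 2 / c0 by rewrite divr_gt0.
have c_gt0 : 0 < c by rewrite !addr_gt0.
exists c; split => // sigma' lf' HC' Hfin'.
have [sigma sigmaE] := sigma_finite_balls (fun t => locally_finite_ball t lf').
move: HC' Hfin'; rewrite -sigmaE => HC Hfin'.
have bs := ball_function_measure sigma.
have Hfin : (wolff_tail N e sigma (origin R n) 1 < +oo)%E.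
  (* The hypothesis integrates over the closed half-line from 1, the tail over the open one; the
     endpoint is negligible. *)
  apply: le_lt_trans Hfin'; rewrite le_eqVlt; apply/orP; left; apply/eqP.
  rewrite /wolff_tail rayE integral_itv_obnd_cbnd; last first.
    by apply: measurable_funTS; exact: measurable_wolff_den2.
  by congr (integral _ _ _); apply/seteqP; split => t /=; rewrite in_itv/= andbT.
set w := wolff_tail N e sigma.
have WE (m : set (Rn R n) -> \bar R) x : Wolff alpha p m x = wolff_tail N e m x 0 by [].
have w0 x : (0 <= w x 0%R)%E by exact: wolff_tail_ge0.
have mw : measurable_fun setT (w ^~ 0) by exact: measurable_wolff_tail1.
have mwg : measurable_fun setT (fun x => poweR (w x 0%R) gam) by exact: measurable_poweR_fun.
pose u0 x := (maxe r%:E (c0%:E * poweR (w x 0%R) gam))%E.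
pose v x := (c1%:E * (r%:E + poweR (w x 0%R) gam))%E.
have mu0 : measurable_fun setT u0.
  by apply: measurable_maxe => //; exact: measurable_funeM.
have mv : measurable_fun setT v.
  by apply: measurable_funeM; exact: emeasurable_funD.
have u0r x : (r%:E <= u0 x)%E by rewrite le_max lexx.
have u0w x : (c0%:E * poweR (w x 0%R) gam <= u0 x)%E by rewrite le_max lexx orbT.
have r0E : (0 <= r%:E :> \bar R)%E by rewrite lee_fin ltW.
have u0v x : (u0 x <= v x)%E.
  rewrite /v ge0_muleDr ?poweR_ge0// ge_max; apply/andP; split.
    apply: (@le_trans _ _ (c1%:E * r%:E)%E); first by rewrite -EFinM lee_fin ler_peMl// ltW.
    by rewrite leeDl// mule_ge0 ?poweR_ge0// lee_fin ltW.
  apply: (@le_trans _ _ (c1%:E * poweR (w x 0%R) gam)%E).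
    by apply: lee_wpmul2r; [exact: poweR_ge0|rewrite lee_fin].
  by rewrite leeDr// mule_ge0// lee_fin ltW.
have sub x : (u0 x <= wolff_tail N e (density_measure sigma u0 q) x 0 + r%:E)%E.
  rewrite ge_max; apply/andP; split.
    by rewrite leeDr// wolff_tail_ge0//; exact: ball_function_density_measure.
  by apply: le_trans (Hsub sigma u0 mu0 u0w x) _; rewrite leeDl.
have u00 x : (0 <= u0 x)%E by exact: le_trans (u0r x).
have [u [mu u0u uv uE]] := sub_super_solution e0 q0 mu0 mv u00 u0v sub
  (Hsuper sigma HC Hfin).
have ugt0 x : (0 < u x)%E by apply: lt_le_trans (le_trans (u0r x) (u0u x)); rewrite lte_fin.
have uLloc (s : R) : 0 < s -> Lloc sigma s u.
  move=> s0; apply: (wolff_power_Lloc r0 p1 q0 qp alpha0 alphap C0 c10 s0 HC Hfin mu) => //.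
  by move=> x; exact: ltW.
exists u; split => //; [by split => //; exact: uLloc|move=> x; rewrite !WE -/w; split].
  have g0 : (0 <= poweR (w x 0%R) gam)%E by exact: poweR_ge0.
  have ci0 : 0 <= c^-1 by rewrite invr_ge0 ltW.
  (* Half of u0 pays for r and the other half for the power, since u0 is their maximum up to the
     factor c0. *)
  apply: (@le_trans _ _ ((2^-1)%:E * u0 x + (2^-1)%:E * u0 x)%E).
    rewrite ge0_muleDr//; apply: leeD.
      apply: (@le_trans _ _ ((2^-1)%:E * r%:E)%E); last first.
        by apply: lee_wpmul2l; [rewrite lee_fin invr_ge0|exact: u0r].
      apply: lee_wpmul2r => //; rewrite lee_fin lef_pV2 ?posrE// /c; lra.
    apply: (@le_trans _ _ ((2^-1)%:E * (c0%:E * poweR (w x 0%R) gam))%E); last first.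
      by apply: lee_wpmul2l; [rewrite lee_fin invr_ge0|exact: u0w].
    rewrite muleA -EFinM; apply: lee_wpmul2r => //; rewrite lee_fin.
    have -> : 2^-1 * c0 = (2 / c0)^-1 by rewrite invfM invrK.
    by rewrite lef_pV2 ?posrE// /c lerDr; lra.
  rewrite -ge0_muleDl ?lee_fin ?invr_ge0// -EFinD.
  rewrite (_ : 2^-1 + 2^-1 = 1); last by field.
  by rewrite mul1e; exact: u0u.
apply: le_trans (uv x) _; apply: lee_wpmul2r; first by rewrite adde_ge0 ?poweR_ge0.
by rewrite lee_fin /c -addrA lerDl; lra.
Qed.
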